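(* Let $\Delta_M=\lim_{\mathrm{SNR}\to\infty}\Delta(\mathrm{SNR},M)$ be the high-SNR limit of the gap between the white-input mutual information and the ergodic mutual information of isotropic randomly beamformed Alamouti modulation with $M$ transmit antennas, and let $\Delta=\lim_{M\to\infty}\Delta_M$. Then $$\Delta=1-\left(\log_2 e-\gamma\right)\approx 0.39\ \text{bits/symbol},\qquad\text{where }\gamma=\int_0^\infty\log_2\!\left(\frac1z\right)e^{-z}\,dz\approx 0.833 .$$
   Context: Let $M$ be the number of transmit antennas and let $\boldsymbol{h}\in\mathbb{C}^M$ be a fixed channel vector of a multiple-input single-output channel, normalized so that $\|\boldsymbol{h}\|^2/M=1$. The white-input (WI) mutual information at signal-to-noise ratio $\mathrm{SNR}$ is $I_{\rm OPT}(\mathrm{SNR})=\log_2(1+\mathrm{SNR})$. Let $\mathbf{B}$ be a random $M\times M$ unitary matrix drawn from the circular unitary ensemble (Haar measure on the unitary group), and let $\boldsymbol{b}_1,\boldsymbol{b}_2$ be its first two columns. The ergodic mutual information of isotropic randomly beamformed Alamouti modulation (IR-BF-A) is $$I_{\rm IR\text{-}BF\text{-}A}(\mathrm{SNR},M)=E_{\mathbf{B}}\left[\log_2\left(1+\frac{\mathrm{SNR}}{2}\left(|\boldsymbol{h}^T\boldsymbol{b}_1|^2+|\boldsymbol{h}^T\boldsymbol{b}_2|^2\right)\right)\right],$$ which depends on $\boldsymbol{h}$ only through its norm. The gap is $$\Delta(\mathrm{SNR},M)=I_{\rm OPT}(\mathrm{SNR})-I_{\rm IR\text{-}BF\text{-}A}(\mathrm{SNR},M).$$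 The limit $\Delta$ is called the maximal gap to the WI mutual information; that $\Delta_M$ is largest as $M\to\infty$ is a numerical observation and is not part of the claim. The constant $\gamma$ is defined with a base-2 logarithm, i.e. it is the usual Euler constant divided by $\ln 2$. *)

(* Defs.v *)
From HB Require Import structures.
From mathcomp Require Import all_boot all_order all_algebra.
From mathcomp Require Import complex.
From mathcomp Require Import all_classical all_reals all_analysis.

Set Implicit Arguments.
Unset Strict Implicit.
Unset Printing Implicit Defensive.

Import Order.TTheory GRing.Theory Num.Theory.
Import numFieldNormedType.Exports.

Local Open Scope classical_set_scope.
Local Open Scope ring_scope.

(* The ascription makes the library's topology on a numClosedFieldType (the
   one given by the modulus) available on R[i]. *)
Notation Cplx R := (R%type[i] : numClosedFieldType).

(* Complex M x M matrices with their Borel sigma-algebra, i.e. the one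
   generated by the open sets of the (entrywise) topology. *)
Notation borelMx R M := (g_sigma_algebraType (@open 'M[Cplx R]_M)).

(* The circular unitary ensemble: the translation-invariant probability
   measure on U(M), seen as a measure on all M x M matrices that is carried by
   the (closed) set of unitary matrices. U(M) being compact, its Haar measure
   is invariant on both sides. *)
Record is_CUE (R : realType) (M : nat) (mu : probability (borelMx R M) R) : Prop :=
  IsCUE {
    CUE_unitary :
      mu [set B : 'M[Cplx R]_M | B \is @spectral.unitarymx (Cplx R) M M] = 1%E ;
    CUE_mull : forall U : 'M[Cplx R]_M, U \is @spectral.unitarymx (Cplx R) M M ->
      forall A : set (borelMx R M), measurable A ->
        mu ((fun B : 'M[Cplx R]_M => U *m B) @^-1` A) = mu A ;
    CUE_mulr : forall U : 'M[Cplx R]_M, U \is @spectral.unitarymx (Cplx R) M M ->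
      forall A : set (borelMx R M), measurable A ->
        mu ((fun B : 'M[Cplx R]_M => B *m U) @^-1` A) = mu A
  }.

Definition log2 (R : realType) (x : R) : R := ln x / ln 2.

(* The library's norm on R[i] takes values in R[i]; normc is the R-valued
   modulus. *)
Definition sqnorm (R : realType) (M : nat) (h : 'cV[Cplx R]_M) : R :=
  \sum_(i < M) Normc.normc (h i 0) ^+ 2.

(* |h^T b_1|^2 + |h^T b_2|^2 for the first two columns b_1, b_2 of B, which are
   those of index 0 and 1; meaningful for M >= 2. *)
Definition alamouti_gain (R : realType) (M : nat) (h : 'cV[Cplx R]_M)
    (B : 'M[Cplx R]_M) : R :=
  \sum_(j < M | (j < 2)%N) Normc.normc ((h^T *m col j B) 0 0) ^+ 2.

Definition I_OPT (R : realType) (snr : R) : R := log2 (1 + snr).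

(* mu is the law of B. For snr >= 0 the integrand lies between 0 and
   log2 (1 + snr / 2 * sqnorm h) on unitary matrices, so that the expectation
   is finite. *)
Definition I_IRBFA (R : realType) (M : nat) (h : 'cV[Cplx R]_M)
    (mu : probability (borelMx R M) R) (snr : R) : R :=
  fine ('E_mu[fun B : 'M[Cplx R]_M => log2 (1 + snr / 2 * alamouti_gain h B)])%E.

Definition MI_gap (R : realType) (M : nat) (h : 'cV[Cplx R]_M)
    (mu : probability (borelMx R M) R) (snr : R) : R :=
  I_OPT snr - I_IRBFA h mu snr.

Definition gamma2 (R : realType) : R :=
  \int[@lebesgue_measure R]_(z in `]0, +oo[) (log2 (1 / z) * expR (- z)).

(* Main.v *)
Require Import Defs.
From mathcomp Require Import all_boot all_order all_algebra.
From mathcomp Require Import complex.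
From mathcomp Require Import all_classical all_reals all_analysis.
From mathcomp Require Import measurable_realfun ring lra zify.
Import Order.TTheory GRing.Theory Num.Theory.
Import numFieldNormedType.Exports.
Local Open Scope classical_set_scope.
Local Open Scope ring_scope.
Set Implicit Arguments.
Unset Strict Implicit.
Unset Printing Implicit Defensive.

(** The unit row vector [V = h^T B / sqrt M] has a law invariant under right
    multiplication by unitaries, and the gain is [M (1 - s)], where [s] is the
    squared norm of the coordinates of [V] of index at least 2.  The density of
    [s] is never needed: differentiating at angle 0 the invariance of
    [E[Re (conj V_i V_j) s^k]] under the rotations of the plane [(i, j)], with
    [i < 2 <= j], and summing over [i] and [j] gives
    [(M + k) E[s^(k+1)] = (M - 2 + k) E[s^k]], hence all the moments of [s].
    Expanding [- ln (1 - q s)] in powers of [q s] and letting [q] tend to 1 with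
    the signal-to-noise ratio, [E[- ln (1 - s)] = sum_k E[s^k] / k = H_(M-1) - 1]
    by partial fractions.  So [Delta_M ln 2 = ln 2 - 1 + H_(M-1) - ln M], and it
    remains to see that [- int_0^oo ln z exp (- z) dz] is Euler's constant, by
    replacing [exp (- z)] by [(1 - z / N)^N], for which the integral is
    elementary. *)

(** * Logarithm bounds and Euler's constant *)

Section LogBounds.
Variable R : realType.
Implicit Types (x : R) (n : nat).

(** The law of [B] is known only through its invariance, and the integrals run over all matrices,
    unitarity holding merely almost surely. So the integrands are functions of a row that is bounded
    for every [B], and the unit norm is brought in by [CUE_ae] when an integral needs it. The real
    part of conj V_i V_j is a good test function for two reasons. Its integral against any power of
    [s] is zero, so rotations must keep it zero. Its derivative yields |V_j|^2 - |V_i|^2 and,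
    through the power of [s], the square of the real part. A phase change of one coordinate turns
    that square into half of |V_i|^2 |V_j|^2, and the recursion closes on [s] alone. No derivative
    is taken under the integral: the rotated integrand is expanded exactly, with a remainder
    [t ^+ 2] times a uniformly bounded function. As [q] stays below 1, the logarithm is bounded and
    the remainder of its series is controlled uniformly in [s]. *)

Lemma derive_continuous_within (f df : R -> R) a b :
  (forall x, x \in `[a, b] -> is_derive x 1 f (df x)) ->
  {within `[a, b], continuous f}.
Proof.
move=> fd; apply: derivable_within_continuous => x xab.
by have [] := fd x xab.
Qed.

Lemma MVT_closed (f df : R -> R) a b : a <= b ->
  (forall x, x \in `[a, b] -> is_derive x 1 f (df x)) ->
  exists2 c, c \in `[a, b] & f b - f a = df c * (b - a).
Proof.
move=> ab fd; have cf := derive_continuous_within fd.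
have fd' x : x \in `]a, b[ -> is_derive x 1 f (df x).
  by move=> xab; apply: fd; exact: subset_itv_oo_cc xab.
by have [c cab E] := MVT_segment ab fd' cf; exists c.
Qed.

Lemma ge0_derive_le (f df : R -> R) a b : a <= b ->
  (forall x, x \in `[a, b] -> is_derive x 1 f (df x)) ->
  (forall x, x \in `[a, b] -> 0 <= df x) -> f a <= f b.
Proof.
move=> ab fd df0; have [c cab E] := MVT_closed ab fd.
by rewrite -subr_ge0 E mulr_ge0 ?df0// subr_ge0.
Qed.

Lemma is_derive_exprn n x :
  is_derive x 1 (fun y : R => y ^+ n.+1) (n.+1%:R * x ^+ n).
Proof.
have := is_deriveX n.+1 (is_derive_id x (1 : R)).
rewrite (_ : (id : R -> R) ^+ n.+1 = (fun y : R => y ^+ n.+1)); last first.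
  by apply/funext => y; rewrite fctE.
by rewrite /GRing.scale /= mulr1.
Qed.

Definition log_remainder n x : R :=
  - ln (1 - x) - \sum_(k < n) x ^+ k.+1 / k.+1%:R.

Lemma is_derive_log_remainder n x : x < 1 ->
  is_derive x 1 (log_remainder n) (x ^+ n / (1 - x)).
Proof.
move=> x1; have x1' : 0 < 1 - x by rewrite subr_gt0.
elim: n => [|n IH].
  have dl : is_derive x 1 (fun y : R => ln (1 - y)) ((1 - x)^-1 * (0 - 1)).
    apply: (@is_derive1_comp R (@ln R) (fun y => 1 - y)) => //.
    exact: is_derive1_ln.
  rewrite (_ : log_remainder 0 = (fun y => - ln (1 - y))); last first.
    by apply/funext => y; rewrite /log_remainder big_ord0 subr0.
  by apply: is_derive_eq; rewrite expr0; ring.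
have dx : is_derive x 1 (fun y : R => n.+1%:R^-1 * y ^+ n.+1) (x ^+ n).
  have dz := is_deriveZ n.+1%:R^-1 (is_derive_exprn n x).
  apply: (is_derive_eq dz).
  by rewrite /GRing.scale /= mulrA mulVf ?pnatr_eq0// mul1r.
rewrite (_ : log_remainder n.+1 =
    (fun y => log_remainder n y - n.+1%:R^-1 * y ^+ n.+1)); last first.
  by apply/funext => y; rewrite /log_remainder big_ord_recr /=; ring.
apply: is_derive_eq.
by rewrite exprS; field; rewrite lt0r_neq0.
Qed.

(** The remainder vanishes at 0 and its derivative [x ^+ n / (1 - x)] is nonnegative and
    nondecreasing, so the mean value theorem gives both bounds, at the harmless cost of a factor
    [n.+1]. It serves at 1 / 2 for [ln 2] and at [q * s] for the expectation of the logarithm. *)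
Lemma log_remainder_bounds n x : 0 <= x -> x < 1 ->
  0 <= log_remainder n x <= x ^+ n.+1 / (1 - x).
Proof.
move=> x0 x1; have dr y : y \in `[0, x] -> is_derive y 1 (log_remainder n) (y ^+ n / (1 - y)).
  rewrite in_itv/= => /andP[_ yx].
  by apply: is_derive_log_remainder; exact: le_lt_trans yx x1.
have [c] := MVT_closed x0 dr; rewrite in_itv/= => /andP[c0 cx].
rewrite [log_remainder n 0](_ : _ = 0); last first.
  by rewrite /log_remainder subr0 ln1 big1 ?subr0 ?oppr0// => k _; rewrite expr0n mul0r.
have c1 : 0 < 1 - c by rewrite subr_gt0 (le_lt_trans cx).
rewrite !subr0 => ->; apply/andP; split.
  by rewrite mulr_ge0// divr_ge0 ?exprn_ge0// ltW.
rewrite exprSr [leRHS]mulrAC ler_wpM2r// ler_pM ?exprn_ge0 ?invr_ge0 ?(ltW c1)//; first by rewrite lerXn2r ?nnegrE.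
by rewrite lef_pV2 ?posrE//; lra.
Qed.

(** The left side is the midpoint rule for the integral of 1 / t over [1, 1 + x], a lower bound
    because 1 / t is convex. *)
Lemma ln1D_ge_midpoint x : 0 <= x -> 2 * x / (2 + x) <= ln (1 + x).
Proof.
move=> x0; pose f y : R := ln (1 + y) - 2 * y / (2 + y).
suff : f 0 <= f x by rewrite /f addr0 ln1 mulr0 mul0r subr0 subr_ge0.
apply: (@ge0_derive_le f (fun y => y ^+ 2 / ((1 + y) * (2 + y) ^+ 2))) => // y;
  rewrite in_itv/= => /andP[y0 _]; last first.
  by rewrite divr_ge0 ?sqr_ge0// mulr_ge0 ?sqr_ge0// addr_ge0.
have y1 : 0 < 1 + y by rewrite ltr_pwDl.
have y2 : 2 + y != 0 by rewrite lt0r_neq0// ltr_pwDl.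
have dl : is_derive y 1 (fun z : R => ln (1 + z)) ((1 + y)^-1 * (0 + 1)).
  apply: (@is_derive1_comp R (@ln R) (fun z => 1 + z)) => //.
  exact: is_derive1_ln.
have di : is_derive y 1 (fun z : R => (2 + z)^-1) (- (2 + y) ^- 2 *: (0 + 1)).
  exact: is_deriveV.
have dm : is_derive y 1 (fun z : R => 2 * z) (2 *: 1) by exact: is_deriveZ.
have dq := is_deriveB dl (is_deriveM dm di).
apply: (is_derive_eq dq); rewrite /GRing.scale /=.
by field; rewrite y2 lt0r_neq0.
Qed.

(** The trapezoid rule for the same integral, an upper bound by convexity. *)
Lemma ln1D_le_trapezoid x : 0 <= x -> ln (1 + x) <= x * (2 + x) / (2 * (1 + x)).
Proof.
move=> x0; pose f y : R := (y + 1 - (1 + y)^-1) / 2 - ln (1 + y).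
have -> : x * (2 + x) / (2 * (1 + x)) = (x + 1 - (1 + x)^-1) / 2.
  by field; rewrite lt0r_neq0// ltr_pwDl.
suff : f 0 <= f x by rewrite /f addr0 ln1 add0r invr1 subrr mul0r subr0 subr_ge0.
apply: (@ge0_derive_le f (fun y => y ^+ 2 / (2 * (1 + y) ^+ 2))) => // y;
  rewrite in_itv/= => /andP[y0 _]; last first.
  by rewrite divr_ge0 ?sqr_ge0// mulr_ge0 ?sqr_ge0.
have y1 : 0 < 1 + y by rewrite ltr_pwDl.
have dl : is_derive y 1 (fun z : R => ln (1 + z)) ((1 + y)^-1 * (0 + 1)).
  apply: (@is_derive1_comp R (@ln R) (fun z => 1 + z)) => //.
  exact: is_derive1_ln.
have di : is_derive y 1 (fun z : R => (1 + z)^-1) (- (1 + y) ^- 2 *: (0 + 1)).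
  by apply: is_deriveV; rewrite lt0r_neq0.
have dm : is_derive y 1 (fun z : R => z + 1) (1 + 0) by exact: is_deriveD.
have dq := is_deriveB (is_deriveZ 2^-1 (is_deriveB dm di)) dl.
have fE : f = (fun z : R => 2^-1 *: (z + 1 - (1 + z)^-1) - ln (1 + z)).
  by apply/funext => z; rewrite /f mulrC.
rewrite fE; apply: (is_derive_eq dq); rewrite /GRing.scale /=.
by field; rewrite lt0r_neq0.
Qed.

End LogBounds.

Section EulerConstant.
Variable R : realType.
Implicit Types (n k m : nat).

Definition harmonic_sum n : R := \sum_(k < n) k.+1%:R^-1.

Definition euler_seq n : R := harmonic_sum n.+1 - ln n.+1%:R.

Definition euler_const : R := limn euler_seq.

Lemma harmonic_sumS n : harmonic_sum n.+1 = harmonic_sum n + n.+1%:R^-1.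
Proof. by rewrite /harmonic_sum big_ord_recr. Qed.

Lemma ln_natS n : ln n.+2%:R = ln n.+1%:R + ln (1 + n.+1%:R^-1) :> R.
Proof.
rewrite -lnM ?posrE ?ltr0n ?ltr_pwDl ?invr_ge0//; congr ln.
by rewrite mulrDr mulr1 mulfV ?pnatr_eq0// -natr1.
Qed.

(** The error of [euler_seq] is close to 1 / (2 n.+1). Subtracting slightly too much or slightly too
    little gives adjacent sequences at a distance of order 1 / n^2, close enough for the decimals
    after 32 terms. *)
Definition euler_lower n : R := euler_seq n - (2 * n.+1%:R)^-1.
Definition euler_upper n : R := euler_seq n - (2 * n.+2%:R)^-1.

Lemma euler_lower_nondecreasing : nondecreasing_seq euler_lower.
Proof.
apply/nondecreasing_seqP => n; rewrite /euler_lower /euler_seq [harmonic_sum n.+2]harmonic_sumS ln_natS.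
have := @ln1D_le_trapezoid R n.+1%:R^-1; rewrite invr_ge0 ler0n => /(_ isT).
have n0 : 0 < n.+1%:R :> R by rewrite ltr0n.
rewrite -[n.+2%:R]natr1; move: (n.+1%:R : R) n0 => x x0.
(* The trapezoid bound at 1 / x is the mean of 1 / x and 1 / (x + 1), exactly what the monotonicity
   asks for. *)
rewrite [X in _ <= X -> _](_ : _ = (2 * x)^-1 + (2 * (x + 1))^-1); last first.
  by field; rewrite !lt0r_neq0// addr_gt0.
rewrite (_ : (x + 1)^-1 = (2 * (x + 1))^-1 + (2 * (x + 1))^-1); last first.
  by field; rewrite lt0r_neq0// addr_gt0.
lra.
Qed.

Lemma euler_upper_nonincreasing : nonincreasing_seq euler_upper.
Proof.
apply/nonincreasing_seqP => n; rewrite /euler_upper /euler_seq [harmonic_sum n.+2]harmonic_sumS ln_natS.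
have := @ln1D_ge_midpoint R n.+1%:R^-1; rewrite invr_ge0 ler0n => /(_ isT).
have n0 : 0 < n.+1%:R :> R by rewrite ltr0n.
rewrite -[n.+3%:R]natr1 -[n.+2%:R]natr1; move: (n.+1%:R : R) n0 => x x0.
have H : (x + 1)^-1 - (2 * (x + 1 + 1))^-1 + (2 * (x + 1))^-1 <= 2 * x^-1 / (2 + x^-1).
  rewrite -subr_ge0.
  rewrite (_ : _ - _ = 3 / (2 * (2 * x + 1) * (x + 1) * (x + 1 + 1))); last first.
    by field; rewrite !lt0r_neq0//; lra.
  by rewrite divr_ge0// !mulr_ge0//; lra.
lra.
Qed.

Lemma euler_gap_cvg0 : (fun n => (2 * n.+1%:R)^-1 : R) @ \oo --> (0 : R).
Proof.
rewrite -(mulr0 2^-1); under eq_fun do rewrite invfM.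
by apply: cvgM; [exact: cvg_cst | exact: cvg_harmonic].
Qed.

Lemma euler_bracket :
  [/\ limn euler_upper = limn euler_lower, cvgn euler_lower & cvgn euler_upper].
Proof.
apply: adjacent_seq; [exact: euler_lower_nondecreasing|exact: euler_upper_nonincreasing|].
rewrite (_ : _ - _ = (fun n => (2 * n.+1%:R)^-1 - (2 * n.+2%:R)^-1)); last first.
  by apply/funext => n; rewrite !fctE /euler_upper /euler_lower; ring.
rewrite -(subrr 0); apply: cvgB; first exact: euler_gap_cvg0.
have := euler_gap_cvg0.
by rewrite -(cvg_shiftS (fun n => (2 * n.+1%:R)^-1 : R)).
Qed.

Lemma cvg_euler_seq : euler_seq @ \oo --> euler_const.
Proof.
suff : cvgn euler_seq by [].
have [_ cl _] := euler_bracket.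
apply/cvg_ex; exists (limn euler_lower + 0).
rewrite (_ : euler_seq = (fun n => euler_lower n + (2 * n.+1%:R)^-1)).
  by apply: cvgD => //; exact: euler_gap_cvg0.
by apply/funext => n; rewrite /euler_lower subrK.
Qed.

Lemma euler_constE : euler_const = limn euler_lower.
Proof.
have [_ cl _] := euler_bracket.
apply/cvg_lim => //; rewrite -[limn euler_lower]addr0.
rewrite (_ : euler_seq = (fun n => euler_lower n + (2 * n.+1%:R)^-1)).
  by apply: cvgD => //; exact: euler_gap_cvg0.
by apply/funext => n; rewrite /euler_lower subrK.
Qed.

Lemma euler_const_bounds n : euler_lower n <= euler_const <= euler_upper n.
Proof.
have [ul cl cu] := euler_bracket; rewrite euler_constE; apply/andP; split.
  exact: nondecreasing_cvgn_le euler_lower_nondecreasing cl n.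
by rewrite -ul; exact: nonincreasing_cvgn_ge euler_upper_nonincreasing cu n.
Qed.

End EulerConstant.

(** * Decimal bounds *)

Section Numerics.
Variable R : realType.

(** Twenty terms of the series at 1 / 2 leave an error of at most 2^-20. *)
Lemma ln2_bounds : 693 / 10 ^+ 3 + 146 / 10 ^+ 6 <= ln (2 : R) <= 693 / 10 ^+ 3 + 149 / 10 ^+ 6.
Proof.
have := @log_remainder_bounds R 20 (1 / 2); rewrite /log_remainder.
rewrite (_ : 1 - 1 / 2 = 2^-1 :> R); last by lra.
rewrite lnV ?posrE// opprK => /(_ ltac:(lra) ltac:(lra)).
rewrite !big_ord_recr big_ord0 /=.
lra.
Qed.

Lemma harmonic_sum32_bounds :
  4 + 584 / 10 ^+ 4 + 95 / 10 ^+ 6 <= harmonic_sum R 32 <= 4 + 584 / 10 ^+ 4 + 96 / 10 ^+ 6.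
Proof.
rewrite /harmonic_sum !big_ord_recr big_ord0 /=.
lra.
Qed.

Lemma euler_const_ln2 : `|euler_const R / ln 2 - 833 / 1000| < 5 / 10 ^+ 4.
Proof.
have /andP[l1 l2] := ln2_bounds; have /andP[h1 h2] := harmonic_sum32_bounds.
(* Index 31 means 32 terms; 32 being a power of 2, [ln 2] is the only logarithm left. *)
have /andP[] := euler_const_bounds R 31.
rewrite /euler_lower /euler_upper /euler_seq.
rewrite (_ : 32%:R = 2 ^+ 5 :> R); last by rewrite -natrX.
rewrite lnXn// -[ln 2 *+ 5]mulr_natl => g1 g2.
have l0 : 0 < ln 2 :> R by lra.
rewrite distrC ltr_distlC; apply/andP; split.
  by rewrite (ltr_pdivlMr _ _ l0); lra.
by rewrite (ltr_pdivrMr _ _ l0); lra.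
Qed.

Lemma gap_limit_numeric :
  `|1 - (1 / ln 2 - euler_const R / ln 2) - 39 / 100| < 5 / 10 ^+ 3.
Proof.
have /andP[l1 l2] := ln2_bounds.
have := euler_const_ln2; rewrite ltr_distlC => /andP[g1 g2].
have l0 : 0 < ln 2 :> R by lra.
have i1 : 144 / 100 < 1 / ln 2 :> R by rewrite (ltr_pdivlMr _ _ l0); lra.
have i2 : 1 / ln 2 < 289 / 200 :> R by rewrite (ltr_pdivrMr _ _ l0); lra.
rewrite ltr_distlC; apply/andP; split; lra.
Qed.

End Numerics.

(** * Euler's constant as an integral *)

Section ExpApprox.
Variable R : realType.
Implicit Types (x z w : R) (n N : nat).

Lemma bernoulli_inequality w n : 0 <= w <= 1 -> 1 - w ^+ n <= n%:R * (1 - w).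
Proof.
move=> /andP[w0 w1]; elim: n => [|n IH]; first by rewrite expr0 subrr mul0r.
rewrite exprS -natr1 mulrDl mul1r.
have wn1 : w * w ^+ n >= w ^+ n - (1 - w).
  have : w ^+ n <= 1 by rewrite exprn_ile1.
  by move: (w ^+ n) => y y1; nra.
lra.
Qed.

(** Both bounds are powers of bounds on one factor. With [u = z / n], [1 - u <= expR (- u)], and
    [expR (- u) * (1 - u ^+ 2) <= 1 - u] because [expR (- u) * (1 + u) <= 1]. Bernoulli's inequality
    then handles the power of [1 - u ^+ 2]. The upper bound is also the domination in
    [log_exp_integral]. *)
Lemma exp_approx_bounds z N : 0 <= z <= N.+1%:R ->
  expR (- z) * (1 - z ^+ 2 / N.+1%:R) <= (1 - z / N.+1%:R) ^+ N.+1 <= expR (- z).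
Proof.
move=> /andP[z0 zN]; set n := N.+1%:R : R.
have n0 : 0 < n by rewrite ltr0n.
pose u := z / n.
have u0 : 0 <= u by rewrite divr_ge0// ltW.
have u1 : u <= 1 by rewrite ler_pdivrMr// mul1r.
have eN : expR (- z) = expR (- u) ^+ N.+1.
  by rewrite -expRM_natl -/n mulrN /u mulrCA mulfV ?mulr1// lt0r_neq0.
have l1 : 1 - u <= expR (- u) by have := expR_ge1Dx (- u).
have l2 : expR (- u) * (1 - u ^+ 2) <= 1 - u.
  have e1 : expR (- u) * (1 + u) <= 1.
    rewrite -[leRHS](expRxMexpNx_1 u) mulrC ler_wpM2r ?expR_ge0//.
    exact: expR_ge1Dx.
  rewrite (_ : 1 - u ^+ 2 = (1 + u) * (1 - u)); last by ring.
  by rewrite mulrA -[leRHS]mul1r ler_wpM2r// subr_ge0.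
have u2 : 0 <= 1 - u ^+ 2 <= 1.
  by rewrite subr_ge0 exprn_ile1//= gerBl sqr_ge0.
apply/andP; split; last first.
  by rewrite eN -/u lerXn2r ?nnegrE ?expR_ge0// subr_ge0.
apply: (@le_trans _ _ ((expR (- u) * (1 - u ^+ 2)) ^+ N.+1)).
  rewrite exprMn -eN ler_wpM2l ?expR_ge0//.
  have := bernoulli_inequality N.+1 u2; rewrite -/n (_ : 1 - (1 - u ^+ 2) = u ^+ 2); last by ring.
  rewrite (_ : n * u ^+ 2 = z ^+ 2 / n); last by rewrite /u; field; rewrite lt0r_neq0.
  by rewrite lerBlDl -lerBlDr.
by rewrite -/u lerXn2r ?nnegrE ?subr_ge0// mulr_ge0 ?expR_ge0//; case/andP: u2.
Qed.

Lemma cvg_exp_approx z : 0 < z ->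
  (fun n => (1 - z / n.+2%:R) ^+ n.+2) @ \oo --> expR (- z).
Proof.
move=> z0.
have c0 : (fun n : nat => n.+2%:R^-1 : R) @ \oo --> (0 : R).
  by have := @cvg_harmonic R; rewrite -(cvg_shiftS (@harmonic R)).
apply: (@squeeze_cvgr _ _ _ _ (fun n : nat => expR (- z) * (1 - z ^+ 2 * n.+2%:R^-1))
   (fun=> expR (- z))); last exact: cvg_cst.
- near=> n; apply: exp_approx_bounds; rewrite ltW//=.
  near: n; exists (Num.truncn z) => // n /= zn.
  apply: le_trans (ltW (truncnS_gt z)) _; rewrite ler_nat ltnS.
  exact: leq_trans zn _.
- rewrite -[X in _ --> X]mulr1; apply: cvgM; first exact: cvg_cst.
  rewrite -[X in _ --> X]subr0; apply: cvgB; first exact: cvg_cst.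
  by rewrite -(mulr0 (z ^+ 2)); apply: cvgM => //; exact: cvg_cst.
Unshelve. all: by end_near. Qed.

End ExpApprox.

Section LogIntegral.
Variable R : realType.
Implicit Types (x z a b : R) (n N : nat).
Notation mu := (@lebesgue_measure R).

Lemma is_derive_FTC (f F : R -> R) a b : a < b ->
  (forall x, x \in `[a, b] -> is_derive x 1 F (f x)) ->
  {within `[a, b], continuous f} ->
  (\int[mu]_(x in `[a, b]) (f x)%:E = (F b - F a)%:E)%E.
Proof.
move=> ab Ff cf; rewrite (@continuous_FTC2 _ f F)// ?EFinB//.
have cF x : x \in `[a, b] -> {for x, continuous F}.
  move=> xab; apply: differentiable_continuous; apply/derivable1_diffP.
  by have [] := Ff x xab.
- split.
  + by move=> x xab; have [] := Ff x (subset_itv_oo_cc xab).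
  + by apply: cvg_at_right_filter; apply: cF; rewrite in_itv/= lexx ltW.
  + by apply: cvg_at_left_filter; apply: cF; rewrite in_itv/= lexx ltW.
- by move=> x xab; rewrite derive1E; have [_ ->] := Ff x (subset_itv_oo_cc xab).
Qed.

Section Approximant.
Variable n : nat.
Let N : R := n.+1%:R.
Let w z : R := 1 - z / N.
Let c : R := N / (N + 1).

Let N0 : 0 < N. Proof. by rewrite ltr0n. Qed.

Let n1 : 1 + n%:R != 0 :> R.
Proof. by rewrite lt0r_neq0// ltr_pwDl. Qed.

Let n2 : 1 + n%:R + 1 != 0 :> R.
Proof. by rewrite lt0r_neq0// addr_gt0// ltr_pwDl. Qed.

Let power_sum m z : R := \sum_(k < m) w z ^+ k.+1 / k.+1%:R.

Let w_derive z : is_derive z 1 w (- N^-1).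
Proof.
have d1 : is_derive z 1 (fun x : R => N^-1 * x) (N^-1 *: 1) by exact: is_deriveZ.
have d2 : is_derive z 1 (fun x : R => 1 - N^-1 * x) (0 - N^-1 *: 1).
  exact: is_deriveB.
rewrite (_ : w = (fun x : R => 1 - N^-1 * x)); last first.
  by apply/funext => x; rewrite /w mulrC.
by apply: (is_derive_eq d2); rewrite /GRing.scale /= mulr1 sub0r.
Qed.

Let wX_derive k z :
  is_derive z 1 (fun x => w x ^+ k.+1) (k.+1%:R * w z ^+ k * - N^-1).
Proof.
exact: (is_derive1_comp (is_derive_exprn k (w z)) (w_derive z)).
Qed.

Let power_sum_derive m z :
  is_derive z 1 (power_sum m) (- N^-1 * \sum_(k < m) w z ^+ k).
Proof.
elim: m => [|m IH].
  rewrite (_ : power_sum 0 = cst 0); last first.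
    by apply/funext => x; rewrite /power_sum big_ord0.
  by apply: is_derive_eq; rewrite big_ord0 mulr0.
have dz := is_deriveZ m.+1%:R^-1 (wX_derive m z).
rewrite (_ : power_sum m.+1 =
    (fun y => power_sum m y + m.+1%:R^-1 *: w y ^+ m.+1)); last first.
  by apply/funext => y; rewrite /power_sum big_ord_recr /= [_ / _]mulrC.
apply: (is_derive_eq (is_deriveD IH dz)).
rewrite big_ord_recr /= /GRing.scale /= mulrDr; congr (_ + _).
by rewrite !mulrA mulVf ?pnatr_eq0// mul1r mulrC.
Qed.

Lemma log_approximant_integral a : 0 < a < N ->
  (\int[mu]_(z in `[a, N]) (- ln z * w z ^+ n.+1)%:E =
   (c * (power_sum n.+2 a - ln N) + c * (1 - w a ^+ n.+2) * ln a)%:E)%E.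
Proof.
move=> /andP[a0 aN].
(* Integration by parts. Among the primitives of [w z ^+ n.+1], the one vanishing at 0 is chosen, so
   that its quotient by [z] is a polynomial, the geometric sum of [gs] up to a factor;
   [- c * power_sum n.+2 z] is a primitive of that quotient. *)
pose F z := - (c * (1 - w z ^+ n.+2) * ln z) - c * power_sum n.+2 z.
have dF z : z \in `[a, N] -> is_derive z 1 F (- ln z * w z ^+ n.+1).
  rewrite in_itv/= => /andP[az zN]; have z0 := lt_le_trans a0 az.
  have d1 := is_deriveZ c (is_deriveB (is_derive_cst (1 : R) z 1) (wX_derive n.+1 z)).
  have d2 := is_deriveM d1 (is_derive1_ln z0).
  have d3 := is_deriveB (is_deriveN d2) (is_deriveZ c (power_sum_derive n.+2 z)).
  apply: (is_derive_eq d3); rewrite /GRing.scale /=.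
  have wz : w z - 1 = - (z / N) by rewrite /w; ring.
  have gs : 1 - w z ^+ n.+2 = z / N * \sum_(k < n.+2) w z ^+ k.
    by rewrite -opprB subrX1 wz mulNr opprK.
  rewrite !fctE /= gs -[n.+2%:R]natr1 -/N /c /GRing.scale /=.
  move: (\sum_(k < n.+2) w z ^+ k) (w z ^+ n.+1) (ln z) => S W l.
  by field; rewrite n1 n2 lt0r_neq0.
rewrite (is_derive_FTC aN dF); last first.
  apply: continuous_in_subspaceT => z; rewrite inE/= in_itv/= => /andP[az zN].
  have z0 := lt_le_trans a0 az.
  have c2 : {for z, continuous (fun x => w x ^+ n.+1)}.
    have [d _] := wX_derive n z.
    by apply: differentiable_continuous; exact/derivable1_diffP.
  exact: (cvgM (cvgN (continuous_ln z0)) c2).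
congr EFin; rewrite /F.
have -> : power_sum n.+2 N = 0.
  by rewrite /power_sum big1// => k _; rewrite /w mulfV ?lt0r_neq0// subrr expr0n mul0r.
have -> : w N = 0 by rewrite /w mulfV ?lt0r_neq0// subrr.
rewrite expr0n /=; ring.
Qed.

(** The harmonic number comes from [w 0 = 1]; moving to [a] costs at most [a / N] per term, by
    Bernoulli's inequality. *)
Lemma power_sum_bounds a : 0 <= a <= N ->
  harmonic_sum R n.+2 - n.+2%:R * (a / N) <= power_sum n.+2 a <= harmonic_sum R n.+2.
Proof.
move=> /andP[a0 aN].
have w01 : 0 <= w a <= 1.
  by rewrite /w subr_ge0 ler_pdivrMr// mul1r aN gerBl divr_ge0// ltW.
apply/andP; split; last first.
  apply: ler_sum => k _; rewrite ler_pdivrMr ?ltr0n// mulVf ?pnatr_eq0//.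
  by case/andP: w01 => ? ?; rewrite exprn_ile1.
rewrite -[n.+2 in X in _ - X]card_ord -sumr_const mulr_suml -sumrB.
apply: ler_sum => k _; rewrite mul1r ler_pdivlMr ?ltr0n// mulrBl mulVf ?pnatr_eq0//.
have := bernoulli_inequality k.+1 w01; rewrite (_ : 1 - w a = a / N); last by rewrite /w; ring.
by rewrite [_ * k.+1%:R]mulrC lerBlDl -lerBlDr.
Qed.

Lemma boundary_term_bounds a : 0 <= a <= N -> 0 <= c * (1 - w a ^+ n.+2) <= a.
Proof.
move=> /andP[a0 aN].
have w01 : 0 <= w a <= 1.
  by rewrite /w subr_ge0 ler_pdivrMr// mul1r aN gerBl divr_ge0// ltW.
have c0 : 0 <= c by rewrite divr_ge0 ?addr_ge0// ltW.
apply/andP; split.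
  by case/andP: w01 => ? ?; rewrite mulr_ge0// subr_ge0 exprn_ile1.
have := ler_wpM2l c0 (bernoulli_inequality n.+2 w01); rewrite (_ : 1 - w a = a / N); last by rewrite /w; ring.
rewrite -[n.+2%:R]natr1 -/N /c (_ : _ * ((N + 1) * _) = a)//.
by field; rewrite n1 n2.
Qed.

End Approximant.

(** Monotone convergence along the intervals from [n.+2%:R^-1] to 1: the primitive [z - z * ln z]
    bounds each integral by 1. The index [n.+2] keeps the intervals nondegenerate. *)
Let ln_integrable : mu.-integrable `]0, 1] (EFin \o (fun z : R => - ln z)).
Proof.
have mln : measurable_fun setT (fun z : R => - ln z).
  by apply: measurableT_comp => //; exact: measurable_ln.
apply/integrableP; split.
  by apply/measurable_EFinP; apply: measurable_funTS.
pose F n : set R := `[n.+2%:R^-1, 1]%classic.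
have UF : \bigcup_n F n = `]0, 1]%classic.
  apply/seteqP; split => [z [n _]|z].
    rewrite /F /= !in_itv/= => /andP[nz ->]; rewrite andbT.
    by apply: lt_le_trans nz; rewrite invr_gt0 ltr0n.
  rewrite /= in_itv/= => /andP[z0 z1]; exists (Num.truncn z^-1) => //.
  rewrite /F /= in_itv/= z1 andbT invf_ple ?posrE ?ltr0n//.
  by apply: le_trans (ltW (truncnS_gt _)) _; rewrite ler_nat.
have F01 n z : F n z -> 0 < z <= 1.
  move=> Fz; have : (\bigcup_n F n) z by exists n.
  by rewrite UF /= in_itv.
have -> : (\int[mu]_(z in `]0%R, 1%R]) `|(EFin \o (fun z : R => (- ln z)%R)) z| =
    \int[mu]_(z in \bigcup_n F n) (- ln z)%R%:E)%E.
  rewrite UF; apply: eq_integral => z; rewrite inE /= in_itv/= => /andP[z0 z1].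
  by rewrite ger0_norm// oppr_ge0 ln_le0.
have F_int n : (\int[mu]_(z in F n) (- ln z)%R%:E <= 1%:E)%E.
  have a0 : 0 < n.+2%:R^-1 :> R by rewrite invr_gt0 ltr0n.
  have a1 : n.+2%:R^-1 < 1 :> R by rewrite invf_lt1 ?ltr0n// ltr1n.
  have dF z : z \in `[n.+2%:R^-1, 1] ->
      is_derive z 1 (fun z => z - z * ln z : R) (- ln z).
    rewrite in_itv/= => /andP[az z1]; have z0 := lt_le_trans a0 az.
    have d := is_deriveB (is_derive_id z (1 : R))
      (is_deriveM (is_derive_id z (1 : R)) (is_derive1_ln z0)).
    apply: (is_derive_eq d); rewrite /GRing.scale /= mulfV ?lt0r_neq0// mulr1.
    by ring.
  rewrite /F (is_derive_FTC a1 dF); last first.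
    apply: continuous_in_subspaceT => z; rewrite inE/= in_itv/= => /andP[az z1].
    have z0 := lt_le_trans a0 az.
    exact: (cvgN (continuous_ln z0)).
  rewrite ln1 mulr0 subr0 lee_fin opprB gerDl subr_le0.
  apply: (@le_trans _ _ 0); last exact: ltW.
  by rewrite mulr_ge0_le0 ?(ltW a0)// ln_le0// ltW.
have cF : ((\int[mu]_(z in F n) (- ln z)%R%:E)%E @[n --> \oo] -->
    (\int[mu]_(z in \bigcup_n F n) (- ln z)%R%:E)%E).
  apply: ge0_nondecreasing_set_cvg_integral.
  - move=> m n mn; apply/subsetPset => z; rewrite /F /= !in_itv/= => /andP[mz ->].
    by rewrite andbT (le_trans _ mz)// lef_pV2 ?posrE ?ltr0n// ler_nat !ltnS.
  - by move=> n; exact: measurable_itv.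
  - by move=> n; apply/measurable_EFinP; apply: measurable_funTS.
  - by move=> n z /F01 /andP[z0 z1]; rewrite lee_fin oppr_ge0 ln_le0.
apply: (@le_lt_trans _ _ 1%:E); last exact: ltry.
rewrite -(cvg_lim _ cF)//; apply: lime_le; first by apply/cvg_ex; eexists; exact: cF.
by near=> n; exact: F_int.
Unshelve. all: by end_near. Qed.

Let lnexp z : R := - ln z * expR (- z).

Let mlnexp : measurable_fun setT lnexp.
Proof.
apply: measurable_funM.
  by apply: measurableT_comp => //; exact: measurable_ln.
by apply: measurableT_comp => //; exact: measurableT_comp.
Qed.

Let lnexp_abs_integrable : mu.-integrable `]0, +oo[ (EFin \o (fun z => `|lnexp z|)).
Proof.
have i1 : mu.-integrable `]0, +oo[ (EFin \o ((fun z : R => - ln z) \_ `]0, 1])).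
  rewrite -restrict_EFin; apply/integrable_restrict => //.
  apply: integrableS ln_integrable => //.
  exact: measurableI.
(* Beyond 1, half of the exponential decay is spent on the logarithm:
   [ln z <= z <= 2 * expR (z / 2)], and 2 is 4 times the rate 1 / 2 of the density. *)
have i2 : mu.-integrable `]0, +oo[ (EFin \o (fun z => 4 * exponential_pdf (2^-1 : R) z)).
  rewrite (_ : EFin \o _ = (fun z => 4%:E * (EFin \o exponential_pdf (2^-1 : R)) z)%E)//.
  apply: integrableZl => //; apply: (@integrableS _ _ _ _ setT) => //.
  by apply: integrable_exponential_pdf; rewrite invr_gt0.
have i3 : mu.-integrable `]0%R, +oo[ ((EFin \o ((fun z : R => - ln z)%R \_ `]0%R, 1%R])) \+
    (EFin \o (fun z => 4 * exponential_pdf (2^-1 : R) z)%R))%E.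
  by apply: integrableD.
apply: le_integrable i3 => //.
  by apply/measurable_EFinP; apply: measurable_funTS; exact: measurableT_comp.
move=> z /=; rewrite in_itv/= andbT => z0.
rewrite lee_fin normr_id [leRHS]ger0_norm; last first.
  apply: addr_ge0; last by rewrite mulr_ge0// exponential_pdf_ge0.
  by apply: restrict_ge0 => x; rewrite /= in_itv/= => /andP[x0 x1]; rewrite oppr_ge0 ln_le0.
rewrite /lnexp normrM (ger0_norm (expR_ge0 _)) normrN (exponential_pdfE _ (ltW z0)).
have p0 : 0 <= 4 * (2^-1 * expR (- 2^-1 * z)) :> R by rewrite !mulr_ge0 ?expR_ge0.
rewrite patchE; case: ifPn => [|/negP]; rewrite inE/= in_itv/= z0/=.
  move=> z1; rewrite (ler0_norm (ln_le0 z1)).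
  apply: ler_wpDr p0 _; rewrite -[leRHS]mulr1 ler_wpM2l ?oppr_ge0 ?ln_le0//.
  by rewrite -expR0 ler_expR oppr_le0 ltW.
move=> /negP; rewrite -ltNge => z1.
rewrite (_ : point = 0 :> R)// add0r (ger0_norm (ln_ge0 (ltW z1))).
rewrite (_ : - z = - 2^-1 * z + - 2^-1 * z); last by field.
rewrite expRD [leLHS]mulrA [leRHS]mulrA ler_wpM2r ?expR_ge0//.
apply: (@le_trans _ _ (z * expR (- 2^-1 * z))).
  by rewrite ler_wpM2r ?expR_ge0// ltW// ln_sublinear.
rewrite mulNr expRN ler_pdivrMr ?expR_gt0//.
by have := expR_ge1Dx (2^-1 * z); lra.
Qed.

Let approx n z : R := - ln z * (1 - z / n.+2%:R) ^+ n.+2.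

(** A cut-off away from the singularity of [ln], small enough that both the boundary term in
    [ln (lo n)] and the loss in the harmonic sum tend to 0. Starting at [n.+2] makes
    [lo n < n.+2%:R] strict. *)
Let lo n : R := (n.+2%:R ^+ 2)^-1.

Let approx_value n : R := n.+2%:R / (n.+2%:R + 1) *
  (\sum_(k < n.+3) (1 - lo n / n.+2%:R) ^+ k.+1 / k.+1%:R - ln n.+2%:R) +
  n.+2%:R / (n.+2%:R + 1) * (1 - (1 - lo n / n.+2%:R) ^+ n.+3) * ln (lo n).

Let lo_bounds n : 0 < lo n < n.+2%:R.
Proof.
have n0 : 0 < n.+2%:R :> R by rewrite ltr0n.
rewrite invr_gt0 exprn_gt0//= invf_plt ?posrE ?exprn_gt0//.
have : 1 < n.+2%:R :> R by rewrite ltr1n.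
move: (n.+2%:R : R) n0 => x x0 x1; apply: (@lt_trans _ _ 1).
  by rewrite invf_lt1.
by rewrite exprn_egt1.
Qed.

Let approx_integral n :
  (\int[mu]_(z in `]0%R, +oo[) ((approx n \_ `[lo n, n.+2%:R]%classic) z)%R%:E)%E =
  (approx_value n)%:E.
Proof.
rewrite -(log_approximant_integral (lo_bounds n)).
transitivity (\int[mu]_(z in `]0%R, +oo[)
    ((EFin \o approx n) \_ `[lo n, n.+2%:R]%classic) z)%E.
  by apply: eq_integral => z _; rewrite restrict_EFin.
rewrite -integral_mkcondr; congr (integral mu _ _).
apply/seteqP; split => z; rewrite /= !in_itv/=; first by case.
move=> zN; split => //; rewrite andbT.
by case/andP: (lo_bounds n) => l0 _; case/andP: zN => /(lt_le_trans l0).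
Qed.

Let cvg_invS k : (fun n => (n + k.+1)%:R^-1 : R) @ \oo --> (0 : R).
Proof.
have := @cvg_harmonic R; rewrite -(@cvg_shiftn k) /=.
by under eq_fun do rewrite /harmonic /= -addnS.
Qed.

Let cvg_approx_value : approx_value n @[n --> \oo] --> euler_const R.
Proof.
(* The sum in [approx_value] has one term more than the integer under the logarithm, whence the
   extra inverse. *)
pose e n : R := euler_seq R n.+1 + (n + 3)%:R^-1.
pose c n : R := 1 - (n + 3)%:R^-1.
have ce : (fun n => c n * e n) @ \oo --> euler_const R.
  rewrite -[euler_const R]mul1r; apply: cvgM.
    by rewrite -[X in _ --> X]subr0; apply: cvgB; [exact: cvg_cst|exact: cvg_invS].
  rewrite -[euler_const R]addr0; apply: cvgD; last exact: cvg_invS.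
  by rewrite (cvg_shiftS (euler_seq R)); exact: cvg_euler_seq.
apply: (@squeeze_cvgr _ _ _ _ (fun n => c n * e n - 3 * (n + 2)%:R^-1)
   (fun n => c n * e n)) => //; last first.
  rewrite -[euler_const R]subr0; apply: cvgB => //.
  by rewrite -(mulr0 3); apply: cvgM; [exact: cvg_cst|exact: cvg_invS].
near=> n.
have lob : 0 <= lo n <= n.+2%:R by case/andP: (lo_bounds n) => /ltW -> /ltW ->.
have /andP[p1 p2] := power_sum_bounds lob.
have /andP[b1 b2] := boundary_term_bounds lob.
rewrite /approx_value; move: p1 p2 b1 b2.
set P := \sum_(k < n.+3) _; set b := _ * (1 - _).
have N0 : 0 < n.+2%:R :> R by rewrite ltr0n.
have N1 : 1 <= n.+2%:R :> R by rewrite ler1n.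
have -> : ln (lo n) = - (2 * ln n.+2%:R).
  by rewrite /lo lnV ?posrE ?exprn_gt0// lnXn// mulr_natl.
have l0 : 0 <= ln n.+2%:R :> R by rewrite ln_ge0.
have l1 : ln n.+2%:R <= n.+2%:R :> R by rewrite ltW// ln_sublinear.
have -> : e n = harmonic_sum R n.+3 - ln n.+2%:R.
  by rewrite /e /euler_seq [harmonic_sum R n.+3]harmonic_sumS addn3; ring.
have -> : c n = n.+2%:R / (n.+2%:R + 1).
  by rewrite /c addn3 -[n.+3%:R]natr1; move: (n.+2%:R : R) N0 => x x0;
    field; rewrite lt0r_neq0// addr_gt0.
rewrite addn2 -[n.+3%:R]natr1 /lo.
move: (n.+2%:R : R) N0 N1 (ln _) l0 l1 (harmonic_sum R n.+3) P b => N N0 N1 l l0 l1 H P b.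
move=> p1 p2 b1 b2.
have M0 : 0 < N + 1 by rewrite addr_gt0.
have c0 : 0 <= N / (N + 1) by rewrite divr_ge0 ?ltW.
have q1 := ler_wpM2l c0 p1; have q2 := ler_wpM2l c0 p2.
have r1 : N / (N + 1) * ((N + 1) * ((N ^+ 2)^-1 / N)) = N ^- 2.
  by field; rewrite !lt0r_neq0.
have i2 : N ^- 2 <= N^-1 by rewrite lef_pV2 ?posrE ?exprn_gt0// ler_eXnr.
have bl : b * l <= N^-1.
  apply: (@le_trans _ _ (N ^- 2 * N)); first by rewrite ler_pM.
  by rewrite expr2 invfM mulfVK ?lt0r_neq0.
have bl0 : 0 <= b * l by rewrite mulr_ge0.
move: q1 q2; rewrite [X in X <= _ -> _]mulrBr r1 !mulrBr => q1 q2.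
move: (N / (N + 1) * H) (N / (N + 1) * P) (N / (N + 1) * l) q1 q2 => cH cP cl q1 q2.
by apply/andP; split; lra.
Unshelve. all: by end_near. Qed.

Lemma log_exp_integral :
  mu.-integrable `]0, +oo[ (EFin \o (fun z : R => - ln z * expR (- z))) /\
  \int[mu]_(z in `]0, +oo[) (- ln z * expR (- z)) = euler_const R.
Proof.
pose f_ n (z : R) := ((approx n \_ `[lo n, n.+2%:R]%classic) z)%:E.
have mD : measurable (`]0, +oo[%classic : set (measurableTypeR R)) by exact: measurable_itv.
(* Set to 0 outside their window, the approximants are dominated by the absolute value of their
   limit, since (1 - z / N)^N is at most exp (- z) there. *)
have [|||||ilnexp _ cv] := @dominated_convergence _ _ R mu _ mD f_ (EFin \o lnexp)
   (EFin \o (fun z => `|lnexp z|)).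
- move=> n; apply/measurable_EFinP; apply: measurable_funTS.
  apply/measurable_restrict => //; apply: measurable_funTS.
  apply: measurable_funM.
    by apply: measurableT_comp => //; exact: measurable_ln.
  by apply: measurable_funX; apply: measurable_funB => //; exact: measurable_funM.
- by apply/measurable_EFinP; exact: measurable_funTS.
- apply: aeW => z; rewrite /= in_itv/= andbT => z0.
  apply: cvg_EFin; first by near=> n.
  have H : (fun n => - ln z * (1 - z / n.+2%:R) ^+ n.+2) @ \oo --> lnexp z.
    by apply: cvgM; [exact: cvg_cst|exact: cvg_exp_approx].
  apply: cvg_trans H; apply: near_eq_cvg; near=> n.
  rewrite /f_ /= patchE ifT// inE/= in_itv/=; apply/andP; split.
    rewrite /lo invf_ple ?posrE ?exprn_gt0 ?ltr0n//.
    apply: (@le_trans _ _ n.+2%:R); last by rewrite ler_eXnr// ler1n.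
    near: n; exists (Num.truncn z^-1) => // n /= zn.
    apply: le_trans (ltW (truncnS_gt z^-1)) _; rewrite ler_nat ltnS.
    exact: leq_trans zn _.
  near: n; exists (Num.truncn z) => // n /= zn.
  apply: le_trans (ltW (truncnS_gt z)) _; rewrite ler_nat ltnS.
  exact: leq_trans zn _.
- exact: lnexp_abs_integrable.
- apply: aeW => z n; rewrite /= in_itv/= andbT => z0.
  rewrite lee_fin patchE; case: ifPn => [|_]; last by rewrite normr0.
  rewrite inE/= in_itv/= => /andP[z1 z2].
  rewrite /approx /lnexp [leLHS]normrM [leRHS]normrM ler_wpM2l//.
  have zn : 0 <= z <= n.+2%:R by rewrite ltW.
  have /andP[_ u] := exp_approx_bounds zn.
  have w0 : 0 <= 1 - z / n.+2%:R by rewrite subr_ge0 ler_pdivrMr ?mul1r// ltr0n.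
  rewrite (ger0_norm (expR_ge0 _)) (ger0_norm (exprn_ge0 _ w0)).
  exact: u.
split; first exact: ilnexp.
rewrite /Rintegral.
have : [sequence (\int[mu]_(x in `]0%R, +oo[) f_ n x)%E]_n @ \oo --> (euler_const R)%:E.
  under eq_fun do rewrite /f_ approx_integral.
  by apply: cvg_EFin; [exact: nearW | exact: cvg_approx_value].
move=> /(cvg_unique _ cv) E.
by rewrite -[RHS]/(fine (euler_const R)%:E) -E.
Unshelve. all: by end_near. Qed.

End LogIntegral.

(** * Bounded random variables *)

Section BoundedMeasurable.
Context d (T : measurableType d) (R : realType).
Implicit Types f g : T -> R.

(** The bound holds at every point. Over a probability measure such functions are integrable and
    stable under products, so integrability needs no separate argument for polynomials in the
    coordinates of the row. *)
Definition bounded_measurable f :=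
  measurable_fun setT f /\ exists K, forall x, `|f x| <= K.

Lemma bounded_measurable_cst (c : R) : bounded_measurable (fun=> c).
Proof. by split; [exact: measurable_cst | exists `|c|]. Qed.

Lemma bounded_measurableD f g : bounded_measurable f -> bounded_measurable g ->
  bounded_measurable (fun x => f x + g x).
Proof.
move=> [mf [K fK]] [mg [L gL]]; split; first exact: measurable_funD.
by exists (K + L) => x; rewrite (le_trans (ler_normD _ _))// lerD.
Qed.

Lemma bounded_measurableM f g : bounded_measurable f -> bounded_measurable g ->
  bounded_measurable (fun x => f x * g x).
Proof.
move=> [mf [K fK]] [mg [L gL]]; split; first exact: measurable_funM.
by exists (K * L) => x; rewrite normrM ler_pM.
Qed.

Lemma bounded_measurableN f : bounded_measurable f ->
  bounded_measurable (fun x => - f x).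
Proof.
move=> [mf [K fK]]; split; first exact: measurableT_comp.
by exists K => x; rewrite normrN.
Qed.

Lemma bounded_measurableB f g : bounded_measurable f -> bounded_measurable g ->
  bounded_measurable (fun x => f x - g x).
Proof. by move=> ? ?; apply: bounded_measurableD => //; exact: bounded_measurableN. Qed.

Lemma bounded_measurableX f n : bounded_measurable f ->
  bounded_measurable (fun x => f x ^+ n).
Proof.
move=> bf; elim: n => [|n IH]; first exact: bounded_measurable_cst.
under eq_fun do rewrite exprS; exact: bounded_measurableM.
Qed.

Lemma bounded_measurable_sum (I : Type) (r : seq I) (Q : pred I) (F : I -> T -> R) :
  (forall i, bounded_measurable (F i)) ->
  bounded_measurable (fun x => \sum_(i <- r | Q i) F i x).
Proof.
move=> bF; elim: r => [|i r IH].
  by under eq_fun do rewrite big_nil; exact: bounded_measurable_cst.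
under eq_fun do rewrite big_cons; case: (Q i) => //.
exact: bounded_measurableD.
Qed.

Lemma bounded_measurable_integrable (mu : probability T R) f :
  bounded_measurable f -> mu.-integrable setT (EFin \o f).
Proof.
move=> [mf [K fK]]; apply: measurable_bounded_integrable => //.
  by rewrite (le_lt_trans (probability_le1 _ _)) ?ltry.
exists K; split; first exact: num_real.
by move=> L KL x _; exact: le_trans (fK x) (ltW KL).
Qed.

(* Equality of laws is enough: [phi] and [psi] need not be related by a
   measurable transformation of [T]. *)
Lemma Rintegral_same_law (mu : probability T R) f g :
  bounded_measurable f -> bounded_measurable g ->
  (forall A : set R, measurable A -> mu (f @^-1` A) = mu (g @^-1` A)) ->
  \int[mu]_x f x = \int[mu]_x g x.
Proof.
move=> bf bg fg; rewrite /Rintegral; congr fine.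
have ie (h : T -> R) : bounded_measurable h ->
    (\int[mu]_x (h x)%:E = \int[pushforward mu h]_x x%:E)%E.
  move=> bh; rewrite integral_pushforward//; first exact: bh.1.
  exact: bounded_measurable_integrable.
rewrite !ie//; apply: eq_measure_integral; [exact: bg.1|exact: bf.1|].
by move=> mg mf A mA _; exact: fg.
Qed.

Variable mu : probability T R.

Lemma Rintegral_boundedD f g : bounded_measurable f -> bounded_measurable g ->
  \int[mu]_x (f x + g x) = \int[mu]_x f x + \int[mu]_x g x.
Proof. by move=> bf bg; rewrite RintegralD//; exact: bounded_measurable_integrable. Qed.

Lemma Rintegral_boundedB f g : bounded_measurable f -> bounded_measurable g ->
  \int[mu]_x (f x - g x) = \int[mu]_x f x - \int[mu]_x g x.
Proof. by move=> bf bg; rewrite RintegralB//; exact: bounded_measurable_integrable. Qed.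

Lemma Rintegral_boundedZ (c : R) f : bounded_measurable f ->
  \int[mu]_x (c * f x) = c * \int[mu]_x f x.
Proof. by move=> bf; rewrite RintegralZl//; exact: bounded_measurable_integrable. Qed.

Lemma Rintegral_prob_cst (c : R) : \int[mu]_x c = c.
Proof. by rewrite Rintegral_cst// (congr1 fine (probability_setT mu)) mulr1. Qed.

Lemma Rintegral_bounded_sum (I : Type) (r : seq I) (Q : pred I) (F : I -> T -> R) :
  (forall i, bounded_measurable (F i)) ->
  \int[mu]_x (\sum_(i <- r | Q i) F i x) = \sum_(i <- r | Q i) \int[mu]_x F i x.
Proof.
move=> bF; elim: r => [|i r IH].
  by under eq_Rintegral do rewrite big_nil; rewrite Rintegral_prob_cst big_nil.
under eq_Rintegral do rewrite big_cons; rewrite big_cons; case: (Q i) => //.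
by rewrite Rintegral_boundedD ?IH//; exact: bounded_measurable_sum.
Qed.

Lemma Rintegral_bounded_le f g : bounded_measurable f -> bounded_measurable g ->
  (forall x, f x <= g x) -> \int[mu]_x f x <= \int[mu]_x g x.
Proof.
by move=> bf bg fg; apply: le_Rintegral => //; exact: bounded_measurable_integrable.
Qed.

Lemma Rintegral_bounded_norm f (K : R) : bounded_measurable f ->
  (forall x, `|f x| <= K) -> `|\int[mu]_x f x| <= K.
Proof.
move=> bf fK; rewrite ler_norml -{1}(Rintegral_prob_cst (- K)) -{2}(Rintegral_prob_cst K).
apply/andP; split; apply: Rintegral_bounded_le => //;
  try exact: bounded_measurable_cst.
all: by move=> x; have := fK x; rewrite ler_norml => /andP[].
Qed.

End BoundedMeasurable.

(** * Complex-valued functions and matrix entries *)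

Section ComplexMeasurability.
Context d (T : measurableType d) (R : realType).
Implicit Types f g : T -> Cplx R.

Definition complex_measurable f :=
  measurable_fun setT (fun x => complex.Re (f x)) /\
  measurable_fun setT (fun x => complex.Im (f x)).

Lemma complex_measurable_cst (c : Cplx R) : complex_measurable (fun=> c).
Proof. by split; exact: measurable_cst. Qed.

Lemma complex_measurableD f g : complex_measurable f -> complex_measurable g ->
  complex_measurable (fun x => f x + g x).
Proof.
move=> [fr fi] [gr gi]; split.
  rewrite [X in measurable_fun _ X](_ : _ =
    (fun x => complex.Re (f x) + complex.Re (g x))); first exact: measurable_funD.
  by apply/funext => x; case: (f x) (g x) => [a b] [c e].
rewrite [X in measurable_fun _ X](_ : _ =
  (fun x => complex.Im (f x) + complex.Im (g x))); first exact: measurable_funD.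
by apply/funext => x; case: (f x) (g x) => [a b] [c e].
Qed.

Lemma complex_measurableM f g : complex_measurable f -> complex_measurable g ->
  complex_measurable (fun x => f x * g x).
Proof.
move=> [fr fi] [gr gi]; split.
  rewrite [X in measurable_fun _ X](_ : _ = (fun x =>
    complex.Re (f x) * complex.Re (g x) - complex.Im (f x) * complex.Im (g x))).
    by apply: measurable_funB; exact: measurable_funM.
  by apply/funext => x; case: (f x) (g x) => [a b] [c e].
rewrite [X in measurable_fun _ X](_ : _ = (fun x =>
  complex.Re (f x) * complex.Im (g x) + complex.Im (f x) * complex.Re (g x))).
  by apply: measurable_funD; exact: measurable_funM.
by apply/funext => x; case: (f x) (g x) => [a b] [c e].
Qed.

Lemma complex_measurable_conj f : complex_measurable f ->
  complex_measurable (fun x => (f x)^*).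
Proof.
move=> [fr fi]; split.
  rewrite [X in measurable_fun _ X](_ : _ = (fun x => complex.Re (f x)))//.
  by apply/funext => x; case: (f x) => a b.
rewrite [X in measurable_fun _ X](_ : _ = (fun x => - complex.Im (f x))).
  exact: measurableT_comp.
by apply/funext => x; case: (f x) => a b.
Qed.

Lemma complex_measurable_sum (I : Type) (r : seq I) (F : I -> T -> Cplx R) :
  (forall i, complex_measurable (F i)) ->
  complex_measurable (fun x => \sum_(i <- r) F i x).
Proof.
move=> bF; elim: r => [|i r IH].
  by under eq_fun do rewrite big_nil; exact: complex_measurable_cst.
by under eq_fun do rewrite big_cons; exact: complex_measurableD.
Qed.

End ComplexMeasurability.

Section ComplexParts.
Variable R : realType.

(** A squared modulus free of square roots, so that identities about it fall to [ring]. *)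
Definition sqmod (c : Cplx R) : R := complex.Re c ^+ 2 + complex.Im c ^+ 2.

Lemma normc_sq (c : Cplx R) : Normc.normc c ^+ 2 = sqmod c.
Proof.
by case: c => a b; rewrite /sqmod /= sqr_sqrtr// addr_ge0// sqr_ge0.
Qed.

Lemma sqmod_ge0 (c : Cplx R) : 0 <= sqmod c.
Proof. by rewrite addr_ge0 ?sqr_ge0. Qed.

Lemma sqmodE (c : Cplx R) : c * c^* = (sqmod c)%:C%C.
Proof.
case: c => a b; rewrite /sqmod /=; apply/eqP; rewrite eq_complex /=.
by apply/andP; split; apply/eqP; rewrite ?expr2; ring.
Qed.

Lemma sqmod_eq0 (c : Cplx R) : (sqmod c == 0) = (c == 0).
Proof.
by rewrite /sqmod paddr_eq0 ?sqr_ge0// !sqrf_eq0 [RHS]eq_complex.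
Qed.

Lemma Re_continuous : continuous (fun c : Cplx R => complex.Re c : R).
Proof.
move=> c; apply: (proj2 (@cvgrPdist_lt _ R _ _ (nbhs_filter (c : Cplx R)) _ _)) => e e0.
apply/(@nbhs_ballP _ (Cplx R)); exists (e%:C%C : Cplx R); first by rewrite /= ltcR.
move=> x; rewrite /ball /= => cx; rewrite -ltcR.
apply: le_lt_trans cx; rewrite -raddfB; exact: normc_ge_Re.
Qed.

Lemma Im_continuous : continuous (fun c : Cplx R => complex.Im c : R).
Proof.
move=> c; apply: (proj2 (@cvgrPdist_lt _ R _ _ (nbhs_filter (c : Cplx R)) _ _)) => e e0.
apply/(@nbhs_ballP _ (Cplx R)); exists (e%:C%C : Cplx R); first by rewrite /= ltcR.
move=> x; rewrite /ball /= => cx; rewrite -ltcR.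
apply: le_lt_trans cx; rewrite -raddfB normc_def lecR -sqrtr_sqr.
by rewrite ler_wsqrtr// lerDr sqr_ge0.
Qed.

Lemma entry_complex_measurable (M : nat) (i j : 'I_M) :
  complex_measurable (fun B : borelMx R M => (B : 'M[Cplx R]_M) i j).
Proof.
have cm (g : Cplx R -> R) : continuous g ->
    measurable_fun setT (fun B : borelMx R M => g ((B : 'M[Cplx R]_M) i j)).
  move=> cg; apply: (measurability _ (RGenOpens.measurableE R)).
  move=> _ [_ [a [b ->] <-]]; rewrite setTI; apply: sub_sigma_algebra.
  have cgf : continuous (fun B : 'M[Cplx R]_M => g (B i j)).
    by move=> B; apply: continuous_comp; [exact: coord_continuous | exact: cg].
  by move/continuousP : cgf; apply; exact: interval_open.
by split; apply: cm; [exact: Re_continuous | exact: Im_continuous].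
Qed.

End ComplexParts.

(** * Unitary matrices acting on a coordinate plane *)

Section PlaneUnitary.
Variables (C : numClosedFieldType) (M : nat).
Implicit Types (i j : 'I_M) (v : 'rV[C]_M).

Definition phase_mx (w : C) j : 'M[C]_M := 1%:M + (w - 1) *: delta_mx j j.

Definition rotation_mx (c s : C) i j : 'M[C]_M :=
  1%:M + (c - 1) *: (delta_mx i i + delta_mx j j)
       + s *: (delta_mx j i - delta_mx i j).

Lemma mul_row_deltaE v i j l :
  (v *m delta_mx i j) 0 l = v 0 i * (j == l)%:R.
Proof.
rewrite mxE (bigD1 i)//= mxE eqxx big1 ?addr0 ?[l == j]eq_sym// => k ki.
by rewrite mxE (negbTE ki) mulr0.
Qed.

Lemma mulmx_phase v w j l :
  (v *m phase_mx w j) 0 l = if l == j then w * v 0 j else v 0 l.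
Proof.
rewrite mulmxDr mulmx1 -scalemxAr 2![in LHS]mxE mul_row_deltaE eq_sym.
by case: eqP => [->|_]; rewrite ?mulr0 ?addr0// mulr1; ring.
Qed.

Lemma mulmx_rotation v c s i j l : i != j ->
  (v *m rotation_mx c s i j) 0 l =
    if l == i then c * v 0 i + s * v 0 j
    else if l == j then c * v 0 j - s * v 0 i else v 0 l.
Proof.
move=> ij; rewrite !mulmxDr mulmx1 -!scalemxAr mulmxDr mulmxBr.
move: (mul_row_deltaE v i i l) (mul_row_deltaE v i j l).
move: (mul_row_deltaE v j i l) (mul_row_deltaE v j j l).
move: (v *m _) (v *m _) (v *m _) (v *m _) => a b d e ha hb hd he.
rewrite !mxE ha hb hd he.
rewrite ![_ == l]eq_sym; have [->|li] := eqVneq l i.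
  by rewrite (negbTE ij) /=; ring.
by have [->|lj] := eqVneq l j; rewrite /=; ring.
Qed.

Lemma phase_mx_unitary w j : w * w^* = 1 ->
  phase_mx w j \is @spectral.unitarymx C M M.
Proof.
move=> w1; apply/spectral.unitarymxP; rewrite /phase_mx.
rewrite linearD/= trmx1 linearZ/= trmx_delta map_mxD map_mx1 map_mxZ map_delta_mx.
rewrite mulmxDl mul1mx mulmxDr mulmx1 -scalemxAl -scalemxAr mul_delta_mx scalerA.
rewrite -addrA -!scalerDl !rmorphB !rmorph1 /=.
rewrite (_ : w^* - 1 + _ = w * w^* - 1); last by ring.
by rewrite w1 subrr scale0r addr0.
Qed.

Lemma rotation_mx_unitary c s i j : i != j -> c^* = c -> s^* = s ->
  c ^+ 2 + s ^+ 2 = 1 ->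
  rotation_mx c s i j \is @spectral.unitarymx C M M.
Proof.
move=> ij cc ss cs; apply/spectral.unitarymxP; rewrite /rotation_mx.
(* [P] projects on the plane of [i] and [j], and [J] is a quarter turn in it. On that plane the
   matrix and its adjoint multiply like the conjugate complex numbers c + s J and c - s J. *)
set P := delta_mx i i + delta_mx j j; set J := delta_mx j i - delta_mx i j.
have dd (p q r t : 'I_M) : delta_mx p q *m delta_mx r t =
    (q == r)%:R *: delta_mx p t :> 'M[C]_M.
  by rewrite mul_delta_mx_cond scaler_nat.
have PP : P *m P = P.
  rewrite /P !(mulmxDl, mulmxDr, dd) !eqxx (negbTE ij) eq_sym (negbTE ij).
  by rewrite !scale0r !scale1r !(addr0, add0r).
have PJ : P *m J = J.
  rewrite /P /J !(mulmxDl, mulmxBr, dd) !eqxx (negbTE ij) eq_sym (negbTE ij).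
  by rewrite !scale0r !scale1r !(addr0, add0r, subr0, sub0r) addrC.
have JP : J *m P = J.
  rewrite /P /J !(mulmxBl, mulmxDr, dd) !eqxx (negbTE ij) eq_sym (negbTE ij).
  by rewrite !scale0r !scale1r !(addr0, add0r, subr0, sub0r).
have JJ : J *m J = - P.
  rewrite /P /J !(mulmxBl, mulmxBr, dd) !eqxx (negbTE ij) eq_sym (negbTE ij).
  by rewrite !scale0r !scale1r !(addr0, add0r, subr0, sub0r) opprD addrC.
rewrite [X in _ *m X = _](_ : _ = 1%:M + (c - 1) *: P - s *: J); last first.
  apply/matrixP => p q; rewrite !mxE.
  rewrite !(rmorphD, rmorphM, rmorphB, rmorphN, rmorph1, rmorph_nat) /= cc ss.
  by rewrite ![(q == _) && _]andbC [q == p]eq_sym; ring.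
rewrite !(mulmxDl, mulmxDr) !mulmxN !mul1mx !mulmx1.
rewrite -!scalemxAl -!scalemxAr PP PJ JP JJ.
rewrite !scalerN !scalerA opprK.
have -> : s * s = 1 - c ^+ 2 by rewrite -cs; ring.
by apply/matrixP => p q; rewrite !mxE; ring.
Qed.

End PlaneUnitary.

(** * A random unit vector *)

Section SqNormRow.
Variables (R : realType) (M : nat).
Implicit Types v : 'rV[Cplx R]_M.

Definition sqnorm_row v : R := \sum_l sqmod (v 0 l).

Lemma sqmod_le_sqnorm_row v l : sqmod (v 0 l) <= sqnorm_row v.
Proof.
rewrite /sqnorm_row (bigD1 l)//= lerDl sumr_ge0// => k _; exact: sqmod_ge0.
Qed.

Lemma sqnorm_rowE v :
  (v *m map_mx Num.conj v^T) 0 0 = (sqnorm_row v)%:C%C :> Cplx R.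
Proof.
rewrite mxE /sqnorm_row rmorph_sum/=; apply: eq_bigr => l _.
by rewrite !mxE; exact: sqmodE.
Qed.

Lemma sqnorm_row_mul v (U : 'M[Cplx R]_M) :
  U \is @spectral.unitarymx (Cplx R) M M -> sqnorm_row (v *m U) = sqnorm_row v.
Proof.
move=> /spectral.unitarymxP UU; suff : (sqnorm_row (v *m U))%:C%C = (sqnorm_row v)%:C%C by case.
rewrite -!sqnorm_rowE trmx_mul map_mxM mulmxA -[v *m U *m _]mulmxA UU.
by rewrite mulmx1.
Qed.

Lemma sqmodM (a c : Cplx R) : sqmod (a * c) = sqmod a * sqmod c.
Proof. by case: a c => [a b] [c d]; rewrite /sqmod /=; ring. Qed.

Lemma sqnorm_rowZ (a : Cplx R) v : sqnorm_row (a *: v) = sqmod a * sqnorm_row v.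
Proof.
by rewrite /sqnorm_row mulr_sumr; apply: eq_bigr => l _; rewrite mxE sqmodM.
Qed.

End SqNormRow.

Section UnitarySet.
Variables (R : realType) (M : nat).

(** Unitarity is the vanishing of one measurable real function, the sum of the squared moduli of the
    entries of the defect. Measurability makes the complement a null set in [CUE_ae]. *)
Lemma measurable_unitarymx :
  measurable ([set B | B \is @spectral.unitarymx (Cplx R) M M] : set (borelMx R M)).
Proof.
pose G (i j : 'I_M) (B : borelMx R M) : Cplx R :=
  \sum_k (B : 'M[Cplx R]_M) i k * ((B : 'M[Cplx R]_M) j k)^* - (i == j)%:R.
have mG i j : complex_measurable (G i j).
  apply: complex_measurableD; last exact: complex_measurable_cst.
  apply: complex_measurable_sum => k; apply: complex_measurableM.
    exact: entry_complex_measurable.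
  by apply: complex_measurable_conj; exact: entry_complex_measurable.
pose F (B : borelMx R M) : R := \sum_i \sum_j sqmod (G i j B).
have mF : measurable_fun setT F.
  apply: measurable_sum => i; apply: measurable_sum => j.
  by apply: measurable_funD; apply: measurable_funX; case: (mG i j).
suff -> : [set B | B \is @spectral.unitarymx (Cplx R) M M] = F @^-1` [set 0].
  by rewrite -[X in measurable X]setTI; apply: mF => //; exact: measurable_set1.
apply/seteqP; split => B /=.
  move=> /spectral.unitarymxP BB; rewrite /F big1// => i _; rewrite big1// => j _.
  apply/eqP; rewrite sqmod_eq0 /G subr_eq0; apply/eqP.
  have := congr1 (fun A : 'M[Cplx R]_M => A i j) BB; rewrite !mxE => <-.
  by apply: eq_bigr => k _; rewrite !mxE.
move=> F0; apply/spectral.unitarymxP/matrixP => i j; rewrite !mxE.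
have : sqmod (G i j B) == 0.
  move: F0 => /eqP; rewrite psumr_eq0; last first.
    by move=> k _; apply: sumr_ge0 => l _; exact: sqmod_ge0.
  move=> /allP/(_ i (mem_index_enum _)) /=; rewrite psumr_eq0; last first.
    by move=> k _; exact: sqmod_ge0.
  by move=> /allP/(_ j (mem_index_enum _)).
rewrite sqmod_eq0 /G subr_eq0 => /eqP <-.
by apply: eq_bigr => k _; rewrite !mxE.
Qed.

End UnitarySet.

Section UnitRow.
Variables (R : realType) (M : nat) (h : 'cV[Cplx R]_M).

(* [h^T B / sqrt M], set to [0] when it is not a unit vector: it is bounded
   everywhere and still equivariant under right multiplication by unitaries. *)
Definition unit_row (B : 'M[Cplx R]_M) : 'rV[Cplx R]_M :=
  ((sqnorm_row (h^T *m B) == M%:R)%:R * (Num.sqrt M%:R)^-1)%:C%C *: (h^T *m B).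

Lemma unit_row_mul (B U : 'M[Cplx R]_M) :
  U \is @spectral.unitarymx (Cplx R) M M ->
  unit_row (B *m U) = unit_row B *m U.
Proof.
by move=> uU; rewrite /unit_row mulmxA sqnorm_row_mul// scalemxAl.
Qed.

Lemma sqmod_real (a : R) : sqmod (a%:C%C : Cplx R) = a ^+ 2.
Proof. by rewrite /sqmod /= expr0n addr0. Qed.

Lemma sqnorm_unit_row_le1 B : sqnorm_row (unit_row B) <= 1.
Proof.
rewrite /unit_row sqnorm_rowZ sqmod_real; have [->|_] := eqVneq; last first.
  by rewrite mul0r expr0n mul0r.
rewrite mul1r exprVn sqr_sqrtr// ?ler0n//.
have [->|M0] := eqVneq (M%:R : R) 0; first by rewrite mulr0.
by rewrite mulVf.
Qed.

Lemma sqnorm_tr : sqnorm_row h^T = sqnorm h.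
Proof.
by rewrite /sqnorm_row /sqnorm; apply: eq_bigr => i _; rewrite mxE normc_sq.
Qed.

Lemma unitary_unit_row B : (0 < M)%N -> sqnorm h / M%:R = 1 ->
  B \is @spectral.unitarymx (Cplx R) M M ->
  unit_row B = ((Num.sqrt M%:R)^-1)%:C%C *: (h^T *m B).
Proof.
move=> M0 hM uB; rewrite /unit_row sqnorm_row_mul// sqnorm_tr.
have -> : sqnorm h = M%:R.
  by rewrite -[LHS](@mulfVK _ M%:R) ?hM ?mul1r// pnatr_eq0 -lt0n.
by rewrite eqxx mul1r.
Qed.

Lemma sqnorm_unitary_unit_row B : (0 < M)%N -> sqnorm h / M%:R = 1 ->
  B \is @spectral.unitarymx (Cplx R) M M -> sqnorm_row (unit_row B) = 1.
Proof.
move=> M0 hM uB; rewrite unitary_unit_row// sqnorm_rowZ sqnorm_row_mul//.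
rewrite sqnorm_tr sqmod_real exprVn sqr_sqrtr// ?ler0n//.
by rewrite mulrC.
Qed.

Lemma chan_measurable l :
  complex_measurable (fun B : borelMx R M => (h^T *m (B : 'M[Cplx R]_M)) 0 l).
Proof.
under eq_fun do rewrite mxE; apply: complex_measurable_sum => k.
apply: complex_measurableM; first exact: complex_measurable_cst.
exact: entry_complex_measurable.
Qed.

Lemma unit_row_measurable l :
  complex_measurable (fun B : borelMx R M => unit_row B 0 l).
Proof.
rewrite /unit_row; under eq_fun do rewrite mxE.
apply: complex_measurableM; last exact: chan_measurable.
split => /=; last exact: measurable_cst.
apply: measurable_funM; last exact: measurable_cst.
pose F (B : borelMx R M) := sqnorm_row (h^T *m (B : 'M[Cplx R]_M)).
have mF : measurable_fun setT F.
  apply: measurable_sum => j.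
  by apply: measurable_funD; apply: measurable_funX; case: (chan_measurable j).
rewrite (_ : (fun _ => _) = \1_(F @^-1` [set M%:R])).
  apply: measurable_indic; rewrite -[X in measurable X]setTI.
  by apply: mF => //; exact: measurable_set1.
apply/funext => B; rewrite indicE; congr ((nat_of_bool _)%:R); apply/idP/idP.
  by move=> /eqP FM; apply/mem_set.
by move=> /set_mem /= /eqP.
Qed.

Lemma Re_unit_row_bounded l :
  bounded_measurable (fun B : borelMx R M => complex.Re (unit_row B 0 l)).
Proof.
split; first by case: (unit_row_measurable l).
exists 1 => B; rewrite -(@ler_pXn2r _ 2) ?nnegrE//= expr1n real_normK ?num_real//.
apply: le_trans (le_trans (sqmod_le_sqnorm_row _ l) (sqnorm_unit_row_le1 B)).
by rewrite lerDl sqr_ge0.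
Qed.

Lemma Im_unit_row_bounded l :
  bounded_measurable (fun B : borelMx R M => complex.Im (unit_row B 0 l)).
Proof.
split; first by case: (unit_row_measurable l).
exists 1 => B; rewrite -(@ler_pXn2r _ 2) ?nnegrE//= expr1n real_normK ?num_real//.
apply: le_trans (le_trans (sqmod_le_sqnorm_row _ l) (sqnorm_unit_row_le1 B)).
by rewrite lerDr sqr_ge0.
Qed.

Variable mu : probability (borelMx R M) R.
Hypothesis cue : is_CUE mu.

Lemma Rintegral_unit_row_mul (G : 'rV[Cplx R]_M -> R) (U : 'M[Cplx R]_M) :
  U \is @spectral.unitarymx (Cplx R) M M ->
  bounded_measurable (fun B : borelMx R M => G (unit_row B)) ->
  bounded_measurable (fun B : borelMx R M => G (unit_row B *m U)) ->
  \int[mu]_B G (unit_row B *m U) = \int[mu]_B G (unit_row B).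
Proof.
move=> uU b1 b2; apply: Rintegral_same_law => // A mA.
have mG : measurable ((fun B : borelMx R M => G (unit_row B)) @^-1` A).
  by rewrite -[X in measurable X]setTI; apply: b1.1.
rewrite -(CUE_mulr cue uU mG); congr (mu _).
by apply/seteqP; split => B /=; rewrite unit_row_mul.
Qed.

(** The passage from identities valid on unitary matrices to integrals over all matrices. *)
Lemma CUE_ae (f g : 'M[Cplx R]_M -> R) :
  measurable_fun setT (f : borelMx R M -> R) ->
  measurable_fun setT (g : borelMx R M -> R) ->
  (forall B, B \is @spectral.unitarymx (Cplx R) M M -> f B = g B) ->
  (\int[mu]_B (f B)%:E = \int[mu]_B (g B)%:E)%E.
Proof.
move=> mf mg fg; apply: ae_eq_integral => //; [exact/measurable_EFinP..|].
exists (~` [set B | B \is @spectral.unitarymx (Cplx R) M M]); split.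
- by apply: measurableC; exact: measurable_unitarymx.
- have := @probability_setC _ _ _ mu _ (@measurable_unitarymx R M).
  by rewrite (CUE_unitary cue) subee.

- by move=> B /= nfg uB; apply: nfg => _; rewrite fg.
Qed.

End UnitRow.

(** * Moments of the tail *)

Section UniformlyBounded.
Context {R : realType} {T : Type}.
Implicit Types f g : T -> R -> R.

(** The parameter is the tangent of the rotation angle, kept in [-1, 1]. Measurability in [x] is
    left out: a remainder only has to be bounded. *)
Definition uniformly_bounded f :=
  exists K, forall x t, `|t| <= 1 -> `|f x t| <= K.

Lemma uniformly_boundedD f g : uniformly_bounded f -> uniformly_bounded g ->
  uniformly_bounded (fun x t => f x t + g x t).
Proof.
move=> [K fK] [L gL]; exists (K + L) => x t t1.
by rewrite (le_trans (ler_normD _ _))// lerD ?fK ?gL.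
Qed.

Lemma uniformly_boundedM f g : uniformly_bounded f -> uniformly_bounded g ->
  uniformly_bounded (fun x t => f x t * g x t).
Proof.
move=> [K fK] [L gL]; exists (K * L) => x t t1.
by rewrite normrM ler_pM ?fK ?gL.
Qed.

Lemma uniformly_boundedX f n : uniformly_bounded f ->
  uniformly_bounded (fun x t => f x t ^+ n).
Proof.
move=> [K fK]; exists (K ^+ n) => x t t1.
by rewrite normrX lerXn2r ?fK// nnegrE (le_trans _ (fK x t t1)).
Qed.

Lemma uniformly_bounded_cst (c : R) : uniformly_bounded (fun _ _ => c).
Proof. by exists `|c|. Qed.

Lemma uniformly_bounded_param : uniformly_bounded (fun _ t => t).
Proof. by exists 1. Qed.

(** An exact first-order expansion in [t], standing in for differentiation under the integral. When
    [k = 0] the coefficient [k%:R] cancels the term in [k.-1]. *)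
Lemma exp_taylor (s z r : T -> R) k :
  uniformly_bounded (fun x _ => s x) -> uniformly_bounded (fun x _ => z x) ->
  uniformly_bounded (fun x _ => r x) ->
  exists2 Q : T -> R -> R, uniformly_bounded Q &
    forall x t, (s x - 2 * t * z x + t ^+ 2 * r x) ^+ k =
      s x ^+ k - 2 * k%:R * z x * t * s x ^+ k.-1 + t ^+ 2 * Q x t.
Proof.
move=> us uz ur; elim: k => [|k [Q uQ QE]].
  exists (fun _ _ => 0); first exact: uniformly_bounded_cst.
  by move=> x t; rewrite !expr0; ring.
(* The terms of order at least 2 in the product of the base by the expansion of its [k]-th power,
   divided by [t ^+ 2]. *)
exists (fun x t => (s x + (-2) * (t * z x) + t * t * r x) * Q x t +
   (r x * s x ^+ k + 4 * k%:R * (z x ^+ 2 * s x ^+ k.-1) +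
   (- 2 * k%:R) * (z x * t * r x * s x ^+ k.-1))).
  have ut := uniformly_bounded_param; have uc := uniformly_bounded_cst.
  by do ?[apply: uniformly_boundedD | apply: uniformly_boundedM
         | apply: uniformly_boundedX | assumption | exact: uc | exact: ut].
move=> x t; rewrite exprS QE /=.
case: k {Q uQ QE} (Q x t) => [|k] q /=; first by rewrite !expr0 expr1; ring.
rewrite -!natr1 !exprS; ring.
Qed.

End UniformlyBounded.

Section Moments.
Variables (R : realType) (M : nat) (h : 'cV[Cplx R]_M).
Variable mu : probability (borelMx R M) R.
Hypotheses (cue : is_CUE mu) (M2 : (2 <= M)%N) (hM : sqnorm h / M%:R = 1).
Implicit Types (i j : 'I_M) (v : 'rV[Cplx R]_M).

Definition tail v : R := \sum_(l < M | (2 <= l)%N) sqmod (v 0 l).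

(** With [inner_im], the real and imaginary parts of conj v_i v_j. *)
Definition inner_re i j v : R := complex.Re (v 0 i) * complex.Re (v 0 j) +
  complex.Im (v 0 i) * complex.Im (v 0 j).

Definition inner_im i j v : R := complex.Re (v 0 i) * complex.Im (v 0 j) -
  complex.Im (v 0 i) * complex.Re (v 0 j).

Lemma inner_sq i j v :
  inner_re i j v ^+ 2 + inner_im i j v ^+ 2 = sqmod (v 0 i) * sqmod (v 0 j).
Proof. rewrite /inner_re /inner_im /sqmod; ring. Qed.

Notation V := (unit_row h).
Notation bm f := (bounded_measurable (f : borelMx R M -> R)).

Lemma sqmod_bounded l : bm (fun B => sqmod (V B 0 l)).
Proof.
apply: bounded_measurableD; apply: bounded_measurableX.
  exact: Re_unit_row_bounded.
exact: Im_unit_row_bounded.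
Qed.

Lemma tail_bounded : bm (fun B => tail (V B)).
Proof. by apply: bounded_measurable_sum => l; exact: sqmod_bounded. Qed.

Lemma sqnorm_row_bounded : bm (fun B => sqnorm_row (V B)).
Proof. by apply: bounded_measurable_sum => l; exact: sqmod_bounded. Qed.

Lemma inner_re_bounded i j : bm (fun B => inner_re i j (V B)).
Proof.
by apply: bounded_measurableD; apply: bounded_measurableM;
  (exact: Re_unit_row_bounded || exact: Im_unit_row_bounded).
Qed.

Lemma inner_im_bounded i j : bm (fun B => inner_im i j (V B)).
Proof.
by apply: bounded_measurableB; apply: bounded_measurableM;
  (exact: Re_unit_row_bounded || exact: Im_unit_row_bounded).
Qed.

Lemma Rintegral_unit_row_change (G G' : 'rV[Cplx R]_M -> R) (U : 'M[Cplx R]_M) :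
  U \is @spectral.unitarymx (Cplx R) M M ->
  (forall v, G (v *m U) = G' v) ->
  bm (fun B => G (V B)) -> bm (fun B => G' (V B)) ->
  \int[mu]_B G' (V B) = \int[mu]_B G (V B).
Proof.
move=> uU GG bG bG'; rewrite -(Rintegral_unit_row_mul cue uU bG).
  by apply: eq_Rintegral => B _; rewrite GG.
by under eq_fun do rewrite GG.
Qed.

Lemma tailD1 v j : (2 <= j)%N -> tail v =
  sqmod (v 0 j) + \sum_(l < M | (2 <= l)%N && (l != j)) sqmod (v 0 l).
Proof. by move=> j2; rewrite /tail (bigD1 j). Qed.

Section PairMoments.
Variables i j : 'I_M.
Hypotheses (i2 : (i < 2)%N) (j2 : (2 <= j)%N).

Let ij : i != j.
Proof. by apply: contraTneq j2 => <-; rewrite -ltnNge. Qed.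

(** Multiplying coordinate [j] by ['i] fixes [tail] and multiplies conj v_i v_j by ['i]. Hence the
    moments of its two parts are equal and opposite, so zero, and those of their squares are
    equal. *)
Let W : 'M[Cplx R]_M := phase_mx ('i%C : Cplx R) j.

Let uW : W \is @spectral.unitarymx (Cplx R) M M.
Proof.
apply: phase_mx_unitary; apply/eqP; rewrite eq_complex /=.
by apply/andP; split; apply/eqP; ring.
Qed.

Let tailW v : tail (v *m W) = tail v.
Proof.
rewrite (tailD1 _ j2) [RHS](tailD1 _ j2); congr (_ + _).
  rewrite mulmx_phase eqxx; case: (v 0 j) => a b; rewrite /sqmod /=; ring.
by apply: eq_bigr => l /andP[_ lj]; rewrite mulmx_phase (negbTE lj).
Qed.

Let inner_reW v : inner_re i j (v *m W) = - inner_im i j v.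
Proof.
rewrite /inner_re /inner_im !mulmx_phase eqxx (negbTE ij).
by case: (v 0 i) (v 0 j) => [a b] [c d] /=; ring.
Qed.

Let inner_imW v : inner_im i j (v *m W) = inner_re i j v.
Proof.
rewrite /inner_re /inner_im !mulmx_phase eqxx (negbTE ij).
by case: (v 0 i) (v 0 j) => [a b] [c d] /=; ring.
Qed.

Lemma inner_re_moment k : \int[mu]_B (inner_re i j (V B) * tail (V B) ^+ k) = 0.
Proof.
have bt := bounded_measurableX k tail_bounded.
have br := bounded_measurableM (inner_re_bounded i j) bt.
have bi := bounded_measurableM (inner_im_bounded i j) bt.
have E1 := @Rintegral_unit_row_change
  (fun v => inner_im i j v * tail v ^+ k)
  (fun v => inner_re i j v * tail v ^+ k) W uW _ bi br.
have E2 := @Rintegral_unit_row_change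
  (fun v => inner_re i j v * tail v ^+ k)
  (fun v => (-1) * (inner_im i j v * tail v ^+ k)) W uW _ br
  (bounded_measurableM (bounded_measurable_cst _ _) bi).
have {}E1 := E1 (fun v => ltac:(by rewrite /= tailW inner_imW)).
have {}E2 := E2 (fun v => ltac:(by rewrite /= tailW inner_reW; ring)).
by move: E2; rewrite Rintegral_boundedZ// -E1; lra.
Qed.

Lemma inner_re_sq_moment k :
  2 * \int[mu]_B (inner_re i j (V B) ^+ 2 * tail (V B) ^+ k) =
  \int[mu]_B (sqmod (V B 0 i) * sqmod (V B 0 j) * tail (V B) ^+ k).
Proof.
have bt := bounded_measurableX k tail_bounded.
have br := bounded_measurableM (bounded_measurableX 2 (inner_re_bounded i j)) bt.
have bi := bounded_measurableM (bounded_measurableX 2 (inner_im_bounded i j)) bt.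
have E1 := @Rintegral_unit_row_change
  (fun v => inner_im i j v ^+ 2 * tail v ^+ k)
  (fun v => inner_re i j v ^+ 2 * tail v ^+ k) W uW
  (fun v => ltac:(by rewrite /= tailW inner_imW)) bi br.
under [RHS]eq_Rintegral do rewrite -inner_sq mulrDl.
by rewrite Rintegral_boundedD// -E1; ring.
Qed.

(** The invariance of [inner_re_moment] under the rotation of tangent [t]. With cosine 1 / sqrt (1 +
    t^2), both factors become polynomials in [t] over 1 + t^2, and these denominators drop out
    because the integral is zero. *)
Lemma rotation_moment k (t : R) :
  \int[mu]_B (((1 - t ^+ 2) * inner_re i j (V B) +
               t * (sqmod (V B 0 j) - sqmod (V B 0 i))) *
   (tail (V B) - 2 * t * inner_re i j (V B) +
    t ^+ 2 * (tail (V B) - sqmod (V B 0 j) + sqmod (V B 0 i))) ^+ k) = 0.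
Proof.
pose n : R := 1 + t ^+ 2; have n0 : 0 < n by rewrite ltr_pwDl// sqr_ge0.
pose c : R := (Num.sqrt n)^-1; pose s : R := t * c.
have c2 : c ^+ 2 = n^-1 by rewrite exprVn sqr_sqrtr// ltW.
have s2 : s ^+ 2 = t ^+ 2 * n^-1 by rewrite exprMn c2.
have cs : c * s = t * n^-1 by rewrite mulrCA -expr2 c2.
pose U : 'M[Cplx R]_M := rotation_mx (c%:C%C : Cplx R) (s%:C%C) i j.
have uU : U \is @spectral.unitarymx (Cplx R) M M.
  apply: rotation_mx_unitary => //; try exact: conjc_real.
  rewrite -!rmorphXn -rmorphD/= c2 s2 -[X in X + _]mul1r -mulrDl mulfV ?lt0r_neq0//.
pose G v := inner_re i j v * tail v ^+ k.
pose G' v := n^-1 ^+ k.+1 * (((1 - t ^+ 2) * inner_re i j v +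
               t * (sqmod (v 0 j) - sqmod (v 0 i))) *
   (tail v - 2 * t * inner_re i j v +
    t ^+ 2 * (tail v - sqmod (v 0 j) + sqmod (v 0 i))) ^+ k).
have Ui v : (v *m U) 0 i = (c%:C)%C * v 0 i + (s%:C)%C * v 0 j.
  by rewrite mulmx_rotation// eqxx.
have Uj v : (v *m U) 0 j = (c%:C)%C * v 0 j - (s%:C)%C * v 0 i.
  by rewrite mulmx_rotation// eq_sym (negbTE ij) eqxx.
have reU v : inner_re i j (v *m U) =
    n^-1 * ((1 - t ^+ 2) * inner_re i j v + t * (sqmod (v 0 j) - sqmod (v 0 i))).
  rewrite /inner_re Ui Uj /sqmod.
  case: (v 0 i) (v 0 j) => [a b] [d e] /=.
  transitivity ((c ^+ 2 - s ^+ 2) * (a * d + b * e) +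
    (c * s) * ((d ^+ 2 + e ^+ 2) - (a ^+ 2 + b ^+ 2))); first ring.
  by rewrite c2 s2 cs; ring.
have tU v : tail (v *m U) = n^-1 * (tail v - 2 * t * inner_re i j v +
    t ^+ 2 * (tail v - sqmod (v 0 j) + sqmod (v 0 i))).
  have -> : tail (v *m U) = tail v - sqmod (v 0 j) + sqmod ((v *m U) 0 j).
    rewrite (tailD1 _ j2) (tailD1 v j2) addrC; congr (_ + _).
    rewrite addrAC subrr add0r; apply: eq_bigr => l /andP[l2 lj].
    rewrite mulmx_rotation// (negbTE lj) ifN//.
    by apply: contraTneq l2 => ->; rewrite -ltnNge.
  rewrite Uj /inner_re /sqmod.
  case: (v 0 i) (v 0 j) => [a b] [d e] /=.
  transitivity (tail v - (d ^+ 2 + e ^+ 2) + (c ^+ 2 * (d ^+ 2 + e ^+ 2)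
    - 2 * (c * s) * (a * d + b * e) + s ^+ 2 * (a ^+ 2 + b ^+ 2))); first ring.
  rewrite c2 s2 cs; move: (tail v) => T.
  transitivity ((T - (d ^+ 2 + e ^+ 2)) * (n^-1 * n) + (n^-1 * (d ^+ 2 + e ^+ 2)
    - 2 * (t * n^-1) * (a * d + b * e) + t ^+ 2 * n^-1 * (a ^+ 2 + b ^+ 2))).
    by rewrite mulVf ?lt0r_neq0// mulr1.
  by move: (n^-1) => m; rewrite /n; ring.
have GG v : G (v *m U) = G' v.
  by rewrite /G /G' reU tU exprMn [n^-1 ^+ k.+1]exprS mulrACA.
have bt := tail_bounded; have br := inner_re_bounded i j.
have bi := sqmod_bounded i; have bj := sqmod_bounded j.
have bc := @bounded_measurable_cst _ (borelMx R M) R.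
have bE : bm (fun B => ((1 - t ^+ 2) * inner_re i j (V B) +
               t * (sqmod (V B 0 j) - sqmod (V B 0 i))) *
   (tail (V B) - 2 * t * inner_re i j (V B) +
    t ^+ 2 * (tail (V B) - sqmod (V B 0 j) + sqmod (V B 0 i))) ^+ k).
  do ?[exact: bc | assumption | apply: bounded_measurableD
       | apply: bounded_measurableM
       | apply: bounded_measurableX | apply: bounded_measurableN].
have := @Rintegral_unit_row_change G G' U uU GG
  (bounded_measurableM br (bounded_measurableX k bt))
  (bounded_measurableM (bc _) bE).
rewrite {1}/G' Rintegral_boundedZ// inner_re_moment.
by move/eqP; rewrite mulf_eq0 expf_eq0 invr_eq0 (gt_eqF n0) /= => /eqP.
Qed.

Lemma bounded_uniformly (f : 'M[Cplx R]_M -> R) : bm f ->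
  uniformly_bounded (fun B (_ : R) => f B).
Proof. by move=> [_ [K fK]]; exists K => B t _; exact: fK. Qed.

(* The derivative at [t = 0] of [rotation_moment]. *)
Lemma pair_moment k :
  \int[mu]_B ((sqmod (V B 0 j) - sqmod (V B 0 i)) * tail (V B) ^+ k) =
  k%:R * \int[mu]_B (sqmod (V B 0 i) * sqmod (V B 0 j) * tail (V B) ^+ k.-1).
Proof.
have bt := tail_bounded; have br := inner_re_bounded i j.
have bi := sqmod_bounded i; have bj := sqmod_bounded j.
have bc := @bounded_measurable_cst _ (borelMx R M) R.
have bd : bm (fun B => sqmod (V B 0 j) - sqmod (V B 0 i)).
  exact: bounded_measurableB.
have bDB : bm (fun B => tail (V B) - sqmod (V B 0 j) + sqmod (V B 0 i)).
  by apply: bounded_measurableD => //; exact: bounded_measurableB.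
have [Q [K QK] QE] := exp_taylor k (bounded_uniformly bt)
  (bounded_uniformly br) (bounded_uniformly bDB).
(* [X] is the coefficient of [t] in the integrand of [rotation_moment], and [Y] is what remains
   after division by [t ^+ 2], as [FE] checks. *)
pose X B := (sqmod (V B 0 j) - sqmod (V B 0 i)) * tail (V B) ^+ k
   - 2 * k%:R * (inner_re i j (V B) ^+ 2 * tail (V B) ^+ k.-1).
pose Y B (t : R) := - inner_re i j (V B) * tail (V B) ^+ k +
   (- 2 * k%:R) * ((sqmod (V B 0 j) - sqmod (V B 0 i)) * inner_re i j (V B) * tail (V B) ^+ k.-1) +
   (2 * k%:R) * (inner_re i j (V B) ^+ 2 * t * tail (V B) ^+ k.-1) +
   ((1 - t * t) * inner_re i j (V B) + t * (sqmod (V B 0 j) - sqmod (V B 0 i))) * Q B t.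
have bX : bm X.
  by do ?[exact: bc | assumption | apply: bounded_measurableD
       | apply: bounded_measurableM
       | apply: bounded_measurableX | apply: bounded_measurableN].
have [C CY] : uniformly_bounded Y.
  have ub (f : 'M[Cplx R]_M -> R) : bm f -> uniformly_bounded (fun B (_ : R) => f B).
    exact: bounded_uniformly.
  have ut := @uniformly_bounded_param R 'M[Cplx R]_M.
  have uc := @uniformly_bounded_cst R 'M[Cplx R]_M.
  have uz := ub _ br; have uzN := ub _ (bounded_measurableN br).
  have ud := ub _ bd; have us := ub _ bt.
  have uQ : uniformly_bounded Q by exists K.
  have ut2 : uniformly_bounded (fun (_ : 'M[Cplx R]_M) (t : R) => - (t * t)).
    exists 1 => _ t t1; rewrite normrN normrM -[1]mulr1 ler_pM//.
  by do ?[exact: uc | exact: ut | assumption | apply: uniformly_boundedD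
       | apply: uniformly_boundedM | apply: uniformly_boundedX].
have EX t : 0 < t -> t <= 1 -> `|\int[mu]_B X B| <= C * t.
  move=> t0 t1; have tn : `|t| <= 1 by rewrite ger0_norm// ltW.
  pose F B := ((1 - t ^+ 2) * inner_re i j (V B) +
               t * (sqmod (V B 0 j) - sqmod (V B 0 i))) *
   (tail (V B) - 2 * t * inner_re i j (V B) +
    t ^+ 2 * (tail (V B) - sqmod (V B 0 j) + sqmod (V B 0 i))) ^+ k.
  have bF : bm F.
    by do ?[exact: bc | assumption | apply: bounded_measurableD
       | apply: bounded_measurableM
       | apply: bounded_measurableX | apply: bounded_measurableN].
  pose Z B := inner_re i j (V B) * tail (V B) ^+ k.
  have bZ : bm Z by apply: bounded_measurableM => //; exact: bounded_measurableX.
  have FE B : F B - Z B - t * X B = t ^+ 2 * Y B t.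
    by rewrite /F /Z /X /Y QE; ring.
  have : `|\int[mu]_B (F B - Z B - t * X B)| <= t ^+ 2 * C.
    apply: Rintegral_bounded_norm => [|B].
      apply: bounded_measurableB; first exact: bounded_measurableB.
      exact: bounded_measurableM (bc _) bX.
    by rewrite FE normrM ger0_norm ?sqr_ge0// ler_wpM2l ?sqr_ge0// CY.
  rewrite Rintegral_boundedB; [|exact: bounded_measurableB|
    exact: bounded_measurableM (bc _) bX].
  rewrite Rintegral_boundedB// Rintegral_boundedZ//.
  rewrite rotation_moment inner_re_moment subr0 sub0r normrN normrM (gtr0_norm t0).
  by rewrite expr2 -mulrA ler_pM2l// mulrC.
have X0 : \int[mu]_B X B = 0.
  apply/eqP/negPn/negP; rewrite -normr_gt0 => e0; move: (`|_|) e0 EX => e e0 EX.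
  have C0 : 0 <= C by apply: le_trans (CY 0 0 _); rewrite ?normr0.
  have d0 : 0 < e + C + 1 by rewrite ltr_wpDl// addr_ge0// ltW.
  (* A point of ]0, 1] where [C * t < e], against [EX]. *)
  have := EX (e / (e + C + 1)) (divr_gt0 e0 d0).
  rewrite ler_pdivrMr// mul1r -addrA lerDl addr_ge0// => /(_ isT).
  by rewrite mulrA ler_pdivlMr ?addrA// => H; nra.
move: X0; rewrite /X Rintegral_boundedB; last first.
- by apply: bounded_measurableM => //; apply: bounded_measurableM;
    exact: bounded_measurableX.
- by apply: bounded_measurableM => //; exact: bounded_measurableX.
rewrite Rintegral_boundedZ; last first.
  by apply: bounded_measurableM; exact: bounded_measurableX.
by move/eqP; rewrite subr_eq0 => /eqP ->; rewrite mulrAC inner_re_sq_moment mulrC.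
Qed.

End PairMoments.
Definition tail_moment k : R := \int[mu]_B (tail (V B) ^+ k).

Lemma tail_ge0 v : 0 <= tail v.
Proof. by apply: sumr_ge0 => l _; exact: sqmod_ge0. Qed.

Lemma tail_unit_row_le1 B : tail (V B) <= 1.
Proof.
apply: le_trans (sqnorm_unit_row_le1 h B).
rewrite /tail /sqnorm_row big_mkcond; apply: ler_sum => l _.
by case: ifP => // _; exact: sqmod_ge0.
Qed.

Lemma tail_moment0 : tail_moment 0 = 1.
Proof.
by rewrite /tail_moment; under eq_Rintegral do rewrite expr0; exact: Rintegral_prob_cst.
Qed.

Lemma sum_ord_lt2 (c : R) : \sum_(i < M | (i < 2)%N) c = 2 * c.
Proof. by rewrite (big_ord_narrow M2) sumr_const card_ord mulr_natl. Qed.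

Lemma sum_ord_ge2 (c : R) : \sum_(i < M | (2 <= i)%N) c = (M - 2)%:R * c.
Proof.
have : \sum_(i < M) c = M%:R * c by rewrite sumr_const card_ord mulr_natl.
rewrite (bigID (fun i : 'I_M => (i < 2)%N))/= sum_ord_lt2 => H.
rewrite natrB// mulrBl -H [2 * c + _]addrC addrK.
by apply: eq_bigl => i; rewrite -leqNgt.
Qed.

Lemma sqnorm_row_split v :
  sqnorm_row v = \sum_(i < M | (i < 2)%N) sqmod (v 0 i) + tail v.
Proof.
rewrite /sqnorm_row (bigID (fun i : 'I_M => (i < 2)%N))/=; congr (_ + _).
by apply: eq_bigl => i; rewrite -leqNgt.
Qed.

(** The difference [sqnorm_row - tail] is the weight of the first two coordinates for every [B], so
    sums can be rearranged pointwise; only here is [sqnorm_row] replaced by its almost sure value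
    1. *)
Lemma tail_moment_diff k :
  \int[mu]_B ((sqnorm_row (V B) - tail (V B)) * tail (V B) ^+ k) =
  tail_moment k - tail_moment k.+1.
Proof.
have bt := tail_bounded; have bn := sqnorm_row_bounded.
rewrite /tail_moment -Rintegral_boundedB//; try exact: bounded_measurableX.
congr fine; apply: (CUE_ae cue) => [||B uB].
- have [//] : bm (fun B => (sqnorm_row (V B) - tail (V B)) * tail (V B) ^+ k).
  apply: bounded_measurableM; last exact: bounded_measurableX.
  exact: bounded_measurableB.
- have [//] : bm (fun B => tail (V B) ^+ k - tail (V B) ^+ k.+1).
  by apply: bounded_measurableB; exact: bounded_measurableX.
rewrite sqnorm_unitary_unit_row// ?(ltnW M2)// exprS; ring.
Qed.

(* [pair_moment] summed over all [i < 2 <= j]. *)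
Lemma tail_moment_rec k :
  (M + k)%:R * tail_moment k.+1 = (M - 2 + k)%:R * tail_moment k.
Proof.
have bt := tail_bounded.
have bs := sqmod_bounded; have btk n := bounded_measurableX n bt.
(* Summing |V_j|^2 over [j] gives [tail]; summing |V_i|^2 over [i] gives [sqnorm_row - tail]. *)
have S1 : \sum_(i < M | (i < 2)%N) \sum_(j < M | (2 <= j)%N)
    \int[mu]_B ((sqmod (V B 0 j) - sqmod (V B 0 i)) * tail (V B) ^+ k) =
    2 * tail_moment k.+1 - (M - 2)%:R * (tail_moment k - tail_moment k.+1).
  transitivity (\sum_(i < M | (i < 2)%N) (tail_moment k.+1 -
    (M - 2)%:R * \int[mu]_B (sqmod (V B 0 i) * tail (V B) ^+ k))).
    apply: eq_bigr => i i2.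
    rewrite -sum_ord_ge2 /tail_moment.
    under [X in X - _]eq_Rintegral do rewrite exprS {1}/tail mulr_suml.
    rewrite Rintegral_bounded_sum; last by move=> l; exact: bounded_measurableM.
    rewrite -sumrB; apply: eq_bigr => j _.
    rewrite -Rintegral_boundedB; try exact: bounded_measurableM.
    by apply: eq_Rintegral => B _; rewrite mulrBl.
  rewrite sumrB sum_ord_lt2 -mulr_sumr -tail_moment_diff; congr (_ - _ * _).
  rewrite -Rintegral_bounded_sum; last by move=> l; exact: bounded_measurableM.
  by apply: eq_Rintegral => B _; rewrite -mulr_suml sqnorm_row_split addrK.
(* The double sum factors as [sqnorm_row - tail] times [tail], which restores the power [k]; for
   [k = 0] the factor [k%:R] hides [k.-1]. *)
have S2 : \sum_(i < M | (i < 2)%N) \sum_(j < M | (2 <= j)%N)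
    k%:R * \int[mu]_B (sqmod (V B 0 i) * sqmod (V B 0 j) * tail (V B) ^+ k.-1) =
    k%:R * (tail_moment k - tail_moment k.+1).
  case: k {S1} => [|k]; first by rewrite mul0r big1// => i _; rewrite big1// => j _; rewrite mul0r.
  rewrite -tail_moment_diff.
  have -> : \int[mu]_B ((sqnorm_row (V B) - tail (V B)) * tail (V B) ^+ k.+1) =
    \int[mu]_B (\sum_(i < M | (i < 2)%N) \sum_(j < M | (2 <= j)%N)
      (sqmod (V B 0 i) * sqmod (V B 0 j) * tail (V B) ^+ k)).
    apply: eq_Rintegral => B _; rewrite sqnorm_row_split addrK mulr_suml.
    apply: eq_bigr => i _; rewrite exprS {1}/tail mulr_suml mulr_sumr.
    by apply: eq_bigr => j _; rewrite mulrA.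
  have b3 i j : bm (fun B => sqmod (V B 0 i) * sqmod (V B 0 j) * tail (V B) ^+ k).
    by apply: bounded_measurableM => //; exact: bounded_measurableM.
  rewrite Rintegral_bounded_sum; last first.
    by move=> i; apply: bounded_measurable_sum => j; exact: b3.
  rewrite mulr_sumr; apply: eq_bigr => i _.
  by rewrite Rintegral_bounded_sum// mulr_sumr.
have : \sum_(i < M | (i < 2)%N) \sum_(j < M | (2 <= j)%N)
    \int[mu]_B ((sqmod (V B 0 j) - sqmod (V B 0 i)) * tail (V B) ^+ k) =
    \sum_(i < M | (i < 2)%N) \sum_(j < M | (2 <= j)%N)
    k%:R * \int[mu]_B (sqmod (V B 0 i) * sqmod (V B 0 j) * tail (V B) ^+ k.-1).
  by apply: eq_bigr => i i2; apply: eq_bigr => j j2; exact: pair_moment.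
rewrite S1 S2 => H; rewrite !natrD -[X in (X%:R + _) * _](subnKC M2) natrD; lra.
Qed.

(** The recursion telescopes to two factors above and two below. For [2 < M] these are the moments
    of the Beta law of parameters M - 2 and 2; for [M = 2] they are zero. *)
Lemma tail_momentE k : tail_moment k.+1 =
  (M - 2)%:R * (M - 1)%:R / ((M - 1 + k)%:R * (M + k)%:R).
Proof.
have M1 : (0 < M - 1)%N by rewrite subn_gt0.
elim: k => [|k IH].
  have := tail_moment_rec 0; rewrite tail_moment0 !addn0 mulr1 => H.
  apply: (mulfI (_ : M%:R != 0)); first by rewrite pnatr_eq0 -lt0n (ltnW M2).
  by rewrite H; field; rewrite !pnatr_eq0 -!lt0n M1 (ltnW M2).
have := tail_moment_rec k.+1; rewrite IH.
have -> : (M - 2 + k.+1 = M - 1 + k)%N.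
  by rewrite addnS -addSn -subSn// subSS.
rewrite [(M - 1 + k.+1)%N](_ : _ = M + k)%N; last first.
  by rewrite addnS -addSn -subSn ?(ltnW M2)// subSS subn0.
have n1 : (M + k.+1)%:R != 0 :> R by rewrite addnS pnatr_eq0.
have n2 : (M + k)%:R != 0 :> R by rewrite pnatr_eq0 -lt0n addn_gt0 (ltnW M2).
have n3 : (M - 1 + k)%:R != 0 :> R by rewrite pnatr_eq0 -lt0n addn_gt0 M1.
move: (M + k.+1)%:R (M + k)%:R (M - 1 + k)%:R (M - 1)%:R (M - 2)%:R n1 n2 n3.
move=> a b c d e a0 b0 c0 H; apply: (mulfI a0); rewrite H; field.
by rewrite a0 b0 c0.
Qed.

End Moments.

(** * High-SNR limit *)

Section MomentSeries.
Variables (R : realType) (M : nat).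
Hypothesis M2 : (2 <= M)%N.

Definition moment_series n : R := \sum_(k < n)
  (M - 2)%:R * (M - 1)%:R / ((M - 1 + k)%:R * (M + k)%:R) / k.+1%:R.

(* By partial fractions, with [N = M - 2]. *)
Lemma moment_seriesE n : let N := (M - 2)%N in
  moment_series n = harmonic_sum R n - harmonic_sum R (n + N) + harmonic_sum R N
    - N%:R * (N.+1%:R^-1 - (n + N.+1)%:R^-1).
Proof.
move=> N; rewrite /moment_series -/N.
have -> : (M - 1 = N.+1)%N by rewrite /N -subSn.
have EM k : (M + k = N + k.+2)%N by rewrite /N; lia.
elim: n => [|n IH].
  by rewrite big_ord0 /harmonic_sum big_ord0 !add0n sub0r addNr subrr mulr0 subr0.
rewrite big_ord_recr /= IH addSn !harmonic_sumS EM.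
have -> : (N + n.+2)%:R = n.+1%:R + N%:R + 1 :> R by rewrite -natrD natr1; congr (_%:R); lia.
have -> : (N.+1 + n)%:R = n.+1%:R + N%:R :> R by rewrite -natrD; congr (_%:R); lia.
have -> : (n.+1 + N.+1)%:R = n.+1%:R + N%:R + 1 :> R by rewrite -natrD natr1; congr (_%:R); lia.
have -> : (n + N.+1)%:R = n.+1%:R + N%:R :> R by rewrite -natrD; congr (_%:R); lia.
have -> : (n + N).+1%:R = n.+1%:R + N%:R :> R by rewrite -natrD; congr (_%:R); lia.
rewrite -[N.+1%:R]natr1.
have : 0 <= N%:R :> R by [].
have : 0 < n.+1%:R :> R by rewrite ltr0n.
move: (n.+1%:R : R) (N%:R : R) (harmonic_sum R _) (harmonic_sum R _) (harmonic_sum R _).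
move=> x y a b c x0 y0; field.
by rewrite !lt0r_neq0//; lra.
Qed.

Lemma harmonic_sum_block n N :
  N%:R * (n + N.+1)%:R^-1 <= harmonic_sum R (n + N) - harmonic_sum R n <= N%:R * n.+1%:R^-1.
Proof.
have -> : harmonic_sum R (n + N) - harmonic_sum R n = \sum_(k < N) (n + k).+1%:R^-1.
  by rewrite /harmonic_sum big_split_ord /= [X in X - _]addrC addrK.
have cst (c : R) : N%:R * c = \sum_(k < N) c by rewrite sumr_const card_ord mulr_natl.
rewrite !cst; apply/andP; split; apply: ler_sum => k _.
  by rewrite lef_pV2 ?posrE ?ltr0n ?addnS// ler_nat ltnS leq_add2l ltnW.
by rewrite lef_pV2 ?posrE ?ltr0n// ler_nat ltnS leq_addr.
Qed.

(** With N = M - 2, the limit is H_N - N / (N + 1), and the defect is a block of N inverses minus N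
    copies of the last one: it is nonnegative and at most N / (n + 1). *)
Lemma moment_series_bounds n :
  harmonic_sum R (M - 1) - 1 - M%:R * n.+1%:R^-1 <= moment_series n
  <= harmonic_sum R (M - 1) - 1.
Proof.
rewrite moment_seriesE /=.
have -> : (M - 1 = (M - 2).+1)%N by rewrite -subSn.
have : (M - 2 <= M)%N by exact: leq_subr.
move: (M - 2)%N => N NM; rewrite harmonic_sumS.
have /andP[h1 h2] := harmonic_sum_block n N.
have N1 : N%:R * N.+1%:R^-1 = 1 - N.+1%:R^-1 :> R.
  have : 0 < N.+1%:R :> R by rewrite ltr0n.
  by rewrite -[N.+1%:R]natr1; move: (N%:R : R) => x x0; field; rewrite lt0r_neq0.
have h3 : N%:R * n.+1%:R^-1 <= M%:R * n.+1%:R^-1 :> R.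
  by rewrite ler_wpM2r ?invr_ge0// ler_nat.
have h4 : 0 <= N%:R * (n + N.+1)%:R^-1 :> R by rewrite mulr_ge0 ?invr_ge0.
rewrite mulrBr N1; move: h1 h2 h3 h4.
move: (N%:R / n.+1%:R) (M%:R / n.+1%:R) (N%:R / (n + N.+1)%:R) => a b c.
move: (harmonic_sum R n) (harmonic_sum R (n + N)) (harmonic_sum R N) (N.+1%:R^-1).
move=> x y z t *; apply/andP; split; lra.
Qed.

End MomentSeries.

Section LogExpectation.
Variables (R : realType) (M : nat) (h : 'cV[Cplx R]_M).
Variable mu : probability (borelMx R M) R.
Hypotheses (cue : is_CUE mu) (M2 : (2 <= M)%N) (hM : sqnorm h / M%:R = 1).
Notation V := (unit_row h).

Definition log_expectation (q : R) : R := \int[mu]_B (- ln (1 - q * tail (V B))).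

Let tail01 B : 0 <= tail (V B) <= 1.
Proof. by rewrite tail_ge0 tail_unit_row_le1. Qed.

Let qtail (q : R) B : 0 <= q < 1 -> 0 <= q * tail (V B) <= q.
Proof.
move=> /andP[q0 q1]; have /andP[t0 t1] := tail01 B.
by rewrite mulr_ge0//= -[leRHS]mulr1 ler_wpM2l.
Qed.

Lemma log_tail_bounded (q : R) : 0 <= q < 1 ->
  bounded_measurable (fun B : borelMx R M => - ln (1 - q * tail (V B))).
Proof.
move=> q01; split.
  apply: measurableT_comp => //; apply: measurableT_comp; first exact: measurable_ln.
  apply: measurable_funB => //; apply: measurable_funM => //.
  by case: (tail_bounded h).
case/andP: (q01) => q0 q1.
exists (- ln (1 - q)) => B; have /andP[t0 t1] := qtail B q01.
rewrite normrN ler0_norm; last by rewrite ln_le0// gerBl.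
by rewrite lerN2 ler_ln ?posrE; lra.
Qed.

(** The Taylor remainder is nonnegative, so truncation alone gives a lower bound, where each power
    of [q] is at least [q ^+ n]; above, the powers are replaced by 1 and the remainder is added. *)
Lemma log_expectation_bounds (q : R) n : 0 <= q < 1 ->
  q ^+ n * moment_series R M n <= log_expectation q <=
  moment_series R M n + q ^+ n.+1 / (1 - q).
Proof.
move=> q01; case/andP: (q01) => q0 q1.
have bt := tail_bounded h.
have bk k : bounded_measurable (fun B : borelMx R M =>
    q ^+ k.+1 / k.+1%:R * tail (V B) ^+ k.+1).
  by apply: bounded_measurableM; [exact: bounded_measurable_cst | exact: bounded_measurableX].
have bs : bounded_measurable (fun B : borelMx R M =>
    \sum_(k < n) q ^+ k.+1 / k.+1%:R * tail (V B) ^+ k.+1).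
  by apply: bounded_measurable_sum => k; exact: bk.
have sE : \int[mu]_B (\sum_(k < n) q ^+ k.+1 / k.+1%:R * tail (V B) ^+ k.+1) =
    \sum_(k < n) q ^+ k.+1 / k.+1%:R * tail_moment h mu k.+1.
  rewrite Rintegral_bounded_sum; last by move=> k; exact: bk.
  apply: eq_bigr => k _; rewrite Rintegral_boundedZ//; exact: bounded_measurableX.
have lr B : 0 <= - ln (1 - q * tail (V B)) -
    \sum_(k < n) q ^+ k.+1 / k.+1%:R * tail (V B) ^+ k.+1 <= q ^+ n.+1 / (1 - q).
  have /andP[t0 t1] := qtail B q01.
  have t2 : q * tail (V B) < 1 by exact: le_lt_trans t1 q1.
  have /andP[] := log_remainder_bounds n t0 t2.
  rewrite /log_remainder (eq_bigr (fun k : 'I_n => q ^+ k.+1 / k.+1%:R * tail (V B) ^+ k.+1)); last first.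
    by move=> k _; rewrite exprMn mulrAC.
  move=> -> /= /le_trans; apply.
  rewrite ler_pM ?exprn_ge0 ?invr_ge0 ?subr_ge0 ?(ltW t2)//.
    by rewrite lerXn2r ?nnegrE.
  by rewrite lef_pV2 ?posrE ?subr_gt0// lerD2l lerN2.
have bl := log_tail_bounded q01.
pose m k : R := (M - 2)%:R * (M - 1)%:R / ((M - 1 + k)%:R * (M + k)%:R).
have mE k : tail_moment h mu k.+1 = m k by exact: tail_momentE.
have m0 k : 0 <= m k / k.+1%:R by rewrite !mulr_ge0 ?invr_ge0 ?mulr_ge0.
have msE : moment_series R M n = \sum_(k < n) m k / k.+1%:R by [].
apply/andP; split.
  apply: (@le_trans _ _ (\sum_(k < n) q ^+ k.+1 / k.+1%:R * tail_moment h mu k.+1)).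
    rewrite msE mulr_sumr; apply: ler_sum => k _.
    by rewrite mE [leRHS]mulrAC -[leRHS]mulrA ler_wpM2r// ler_wiXn2l// ltW.
  rewrite -sE; apply: Rintegral_bounded_le => // B.
  by have /andP[] := lr B; rewrite subr_ge0.
apply: (@le_trans _ _ (\sum_(k < n) q ^+ k.+1 / k.+1%:R * tail_moment h mu k.+1 +
   q ^+ n.+1 / (1 - q))).
  rewrite -sE -(Rintegral_prob_cst mu (q ^+ n.+1 / (1 - q))).
  rewrite -Rintegral_boundedD//; last exact: bounded_measurable_cst.
  apply: Rintegral_bounded_le => //.
    by apply: bounded_measurableD => //; exact: bounded_measurable_cst.
  by move=> B; have /andP[_] := lr B; rewrite lerBlDl.
rewrite lerD2r msE; apply: ler_sum => k _.
by rewrite mE mulrAC -mulrA ler_piMl// exprn_ile1// ltW.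
Qed.

(* Letting [n] tend to infinity, at fixed [q] for the upper bound and after
   [q] tends to [1] for the lower one. *)
Lemma cvg_log_expectation (q : R -> R) :
  (\forall x \near +oo, 0 <= q x < 1) -> q x @[x --> +oo] --> (1 : R) ->
  log_expectation (q x) @[x --> +oo] --> harmonic_sum R (M - 1) - 1.
Proof.
move=> q01 cq; set S := harmonic_sum R (M - 1) - 1.
have cms : moment_series R M n @[n --> \oo] --> S.
  apply: (@squeeze_cvgr _ _ _ _ (fun n => S - M%:R * n.+1%:R^-1) (fun=> S)).
  - by apply: nearW => n; exact: moment_series_bounds.
  - rewrite -[X in _ --> X]subr0; apply: cvgB; first exact: cvg_cst.
    by rewrite -(mulr0 M%:R); apply: cvgM; [exact: cvg_cst|exact: cvg_harmonic].
  - exact: cvg_cst.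
have upper x : 0 <= x < 1 -> log_expectation x <= S.
  move=> x01; case/andP: (x01) => x0 x1.
  have cg : (fun n : nat => S + x ^+ n.+1 / (1 - x)) @ \oo --> S.
    rewrite -[X in _ --> X]addr0; apply: cvgD; first exact: cvg_cst.
    rewrite -(mul0r (1 - x)^-1); apply: cvgM; last exact: cvg_cst.
    rewrite (cvg_shiftS (fun n => x ^+ n)); apply: cvg_expr.
    by rewrite ger0_norm.
  rewrite -(cvg_lim _ cg)//; apply: limr_ge; first by apply/cvg_ex; exists S.
  apply: nearW => n; have /andP[_ u] := log_expectation_bounds n x01.
  apply: (le_trans u); rewrite lerD2r.
  by have /andP[] := moment_series_bounds R M2 n.
apply/cvgrPdist_le => e e0.
have e2 : 0 < e / 2 by rewrite divr_gt0.
have [n Hn] : exists n, S - moment_series R M n <= e / 2.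
  move/cvgrPdist_le : cms => /(_ _ e2) [n _ /(_ n (leqnn n))] Hn.
  by exists n; apply: le_trans Hn; exact: ler_norm.
have cqn : q x ^+ n * moment_series R M n @[x --> +oo] --> moment_series R M n.
  rewrite -[X in _ --> X]mul1r; apply: cvgM; last exact: cvg_cst.
  rewrite -(expr1n R n); apply: (@cvg_comp _ _ _ q (fun y => y ^+ n)); first exact: cq.
  exact: exprn_continuous.
move/cvgrPdist_le : cqn => /(_ _ e2) cqn.
near=> x.
have x01 : 0 <= q x < 1 by near: x.
have /andP[l _] := log_expectation_bounds n x01.
rewrite ger0_norm ?subr_ge0 ?upper//.
have : moment_series R M n - q x ^+ n * moment_series R M n <= e / 2.
  by apply: le_trans (ler_norm _) _; near: x.
lra.
Unshelve. all: by end_near. Qed.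

End LogExpectation.

Section Gap.
Variables (R : realType) (M : nat) (h : 'cV[Cplx R]_M).
Variable mu : probability (borelMx R M) R.
Hypotheses (cue : is_CUE mu) (M2 : (2 <= M)%N) (hM : sqnorm h / M%:R = 1).
Notation V := (unit_row h).

Lemma alamouti_gainE B : alamouti_gain h B =
  \sum_(j < M | (j < 2)%N) sqmod ((h^T *m B) 0 j).
Proof.
apply: eq_bigr => j _; rewrite normc_sq; congr sqmod.
by rewrite !mxE; apply: eq_bigr => k _; rewrite !mxE.
Qed.

Lemma unitary_alamouti_gain B : B \is @spectral.unitarymx (Cplx R) M M ->
  alamouti_gain h B = M%:R * (1 - tail (V B)).
Proof.
move=> uB; have M0 : (0 < M)%N by exact: ltnW.
have : sqnorm_row (V B) - tail (V B) = 1 - tail (V B).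
  by rewrite sqnorm_unitary_unit_row.
rewrite sqnorm_row_split addrK => <-; rewrite alamouti_gainE mulr_sumr.
apply: eq_bigr => j _; rewrite unitary_unit_row// [in RHS]mxE sqmodM sqmod_real.
rewrite exprVn sqr_sqrtr// mulrA mulfV ?mul1r//.
by rewrite pnatr_eq0 -lt0n.
Qed.

Lemma alamouti_gain_measurable :
  measurable_fun setT (alamouti_gain h : borelMx R M -> R).
Proof.
rewrite (funext alamouti_gainE); under eq_fun do rewrite big_mkcond.
apply: measurable_sum => j; case: (j < 2)%N; last exact: measurable_cst.
by apply: measurable_funD; apply: measurable_funX; case: (chan_measurable h j).
Qed.

(** On unitary matrices the argument of the logarithm is 1 + a (1 - s) = (1 + a) (1 - q s) with q =
    a / (1 + a), which separates the signal-to-noise ratio from the random factor. *)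
Lemma MI_gapE snr : 0 < snr -> let a := snr * (M%:R / 2) in
  MI_gap h mu snr =
  (ln ((1 + snr) / (1 + a)) + log_expectation h mu (a / (1 + a))) / ln 2.
Proof.
move=> s0 a; have M0 : 0 < M%:R :> R by rewrite ltr0n ltnW.
have a0 : 0 < a by rewrite mulr_gt0// divr_gt0.
have a1 : 0 < 1 + a by rewrite addr_gt0.
pose q := a / (1 + a).
have q01 : 0 <= q < 1.
  by rewrite divr_ge0 ?(ltW a0) ?(ltW a1)//= ltr_pdivrMr// mul1r ltrDr.
have l2 : 0 < ln 2 :> R by rewrite ln_gt0// ltr1n.
rewrite /MI_gap /I_OPT /I_IRBFA /log2 unlock.
have bl := log_tail_bounded h q01.
have bi : bounded_measurable (fun B : borelMx R M =>
    ln (1 + a) / ln 2 - (ln 2)^-1 * (- ln (1 - q * tail (V B)))).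
  apply: bounded_measurableB; first exact: bounded_measurable_cst.
  by apply: bounded_measurableM => //; exact: bounded_measurable_cst.
rewrite (CUE_ae cue (g := fun B =>
    ln (1 + a) / ln 2 - (ln 2)^-1 * (- ln (1 - q * tail (V B))))).
- rewrite -[fine _]/(\int[mu]_B (ln (1 + a) / ln 2 - (ln 2)^-1 * (- ln (1 - q * tail (V B))))).
  rewrite Rintegral_boundedB; last first.
  + by apply: bounded_measurableM => //; exact: bounded_measurable_cst.
  + exact: bounded_measurable_cst.
  rewrite Rintegral_prob_cst Rintegral_boundedZ// ln_div ?posrE ?addr_gt0//.
  by rewrite /log_expectation -/q; field; rewrite lt0r_neq0.
- apply: measurable_funM => //; apply: measurableT_comp; first exact: measurable_ln.
  apply: measurable_funD => //; apply: measurable_funM => //.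
  exact: alamouti_gain_measurable.
- exact: bi.1.
- move=> B uB; rewrite unitary_alamouti_gain//.
  have -> : 1 + snr / 2 * (M%:R * (1 - tail (V B))) = (1 + a) * (1 - q * tail (V B)).
    have key (x t : R) : 0 < 1 + x -> (1 + x) * (1 - x / (1 + x) * t) = 1 + x * (1 - t).
      by move=> x0; field; rewrite lt0r_neq0.
    by rewrite /q key// /a; field.
  have t1 : 0 < 1 - q * tail (V B).
    case/andP: q01 => q0 q1; rewrite subr_gt0; apply: le_lt_trans q1.
    by rewrite -[leRHS]mulr1 ler_wpM2l// tail_unit_row_le1.
  rewrite lnM ?posrE//; ring.
Qed.

Lemma cvg_MI_gap : MI_gap h mu snr @[snr --> +oo] -->
  (ln 2 - ln M%:R + (harmonic_sum R (M - 1) - 1)) / ln 2.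
Proof.
have M0 : 0 < M%:R :> R by rewrite ltr0n ltnW.
(* Numerators and denominators are divided by the signal-to-noise ratio, so that every limit reduces
   to that of the inverse at 0; the quotient of the two growth rates tends to [b^-1], that is 2 /
   M. *)
pose b : R := M%:R / 2; have b0 : 0 < b by rewrite divr_gt0.
have cV : x^-1 @[x --> +oo] --> (0 : R).
  apply/cvgrPdist_lt => e e0; near=> x.
  have ex : e^-1 < x by near: x; apply: nbhs_pinfty_gt; exact: num_real.
  have x0 : 0 < x by apply: lt_trans ex; rewrite invr_gt0.
  by rewrite sub0r normrN gtr0_norm ?invr_gt0// invf_plt ?posrE.
have cu : (x^-1 + b)^-1 @[x --> +oo] --> (b^-1 : R).
  apply: cvgV; first by rewrite lt0r_neq0.
  by rewrite -[X in _ --> X]add0r; apply: cvgD => //; exact: cvg_cst.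
have q1 : (b / (x^-1 + b)) @[x --> +oo] --> (1 : R).
  rewrite -(@mulfV _ b) ?lt0r_neq0//; apply: cvgM => //; exact: cvg_cst.
have r1 : ((x^-1 + 1) / (x^-1 + b)) @[x --> +oo] --> (b^-1 : R).
  rewrite -[X in _ --> X]mul1r; apply: cvgM => //.
  by rewrite -[X in _ --> X]add0r; apply: cvgD => //; exact: cvg_cst.
have lr : ln ((x^-1 + 1) / (x^-1 + b)) @[x --> +oo] --> (ln 2 - ln M%:R : R).
  have -> : ln 2 - ln M%:R = ln b^-1 :> R by rewrite /b invf_div ln_div ?posrE.
  apply: (@cvg_comp _ _ _ (fun x : R => (x^-1 + 1) / (x^-1 + b)) (@ln R)); first exact: r1.
  by apply: continuous_ln; rewrite invr_gt0.
have q01 : \forall x \near +oo, 0 <= (b / (x^-1 + b)) < 1.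
  near=> x; have x0 : 0 < x by near: x; apply: nbhs_pinfty_gt; exact: num_real.
  have i0 : 0 < x^-1 by rewrite invr_gt0.
  have d0 : 0 < x^-1 + b by rewrite addr_gt0.
  by rewrite divr_ge0 ?ltW//= ltr_pdivrMr// mul1r ltrDr.
have cl := cvg_log_expectation cue M2 hM q01 q1.
have C : (fun x => (ln ((x^-1 + 1) / (x^-1 + b)) +
    log_expectation h mu (b / (x^-1 + b))) / ln 2) @ +oo -->
    ((ln 2 - ln M%:R + (harmonic_sum R (M - 1) - 1)) / ln 2 : R).
  exact: cvgM (cvgD lr cl) (cvg_cst ((ln 2)^-1 : R)).
apply: cvg_trans C; apply: near_eq_cvg; near=> x.
have x0 : 0 < x by near: x; apply: nbhs_pinfty_gt; exact: num_real.
rewrite MI_gapE// -/b.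
have d0 : 0 < 1 + x * b by rewrite addr_gt0// mulr_gt0.
have -> : x * b / (1 + x * b) = b / (x^-1 + b).
  have -> : x^-1 + b = (1 + x * b) / x by field; rewrite lt0r_neq0.
  by field; rewrite !lt0r_neq0.
have -> : (1 + x) / (1 + x * b) = (x^-1 + 1) / (x^-1 + b).
  have -> : x^-1 + b = (1 + x * b) / x by field; rewrite lt0r_neq0.
  by field; rewrite !lt0r_neq0.
by [].
Unshelve. all: by end_near. Qed.

End Gap.

(** * Limit in the number of antennas *)

Section EulerLimit.
Variable R : realType.

Lemma gamma2E : gamma2 R = euler_const R / ln 2.
Proof.
have [il E] := log_exp_integral R.
rewrite /gamma2 mulrC -E -RintegralZl//.
apply: eq_Rintegral => z; rewrite inE/= in_itv/= andbT => z0.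
by rewrite /log2 div1r lnV ?posrE//; ring.
Qed.

Definition gap_limit (M : nat) : R :=
  (ln 2 - ln M%:R + (harmonic_sum R (M - 1) - 1)) / ln 2.

Lemma cvg_gap_limit :
  gap_limit M @[M --> \oo] --> 1 - (1 / ln 2 - euler_const R / ln 2).
Proof.
rewrite -(cvg_shiftS gap_limit).
have l2 : 0 < ln 2 :> R by rewrite ln_gt0// ltr1n.
have -> : 1 - (1 / ln 2 - euler_const R / ln 2) = (ln 2 - 1 + (euler_const R - 0)) / ln 2.
  by field; rewrite lt0r_neq0.
(* At M = n + 1 the harmonic sum stops one term before that of [euler_seq n], whence the subtracted
   inverse, which tends to 0. *)
rewrite (_ : (fun n => gap_limit n.+1) =
    (fun n => (ln 2 - 1 + (euler_seq R n - n.+1%:R^-1)) / ln 2)); last first.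
  apply/funext => n; rewrite /gap_limit /euler_seq harmonic_sumS subn1 /=.
  by congr (_ / _); ring.
apply: cvgM; last exact: cvg_cst.
apply: cvgD; first exact: cvg_cst.
by apply: cvgB; [exact: cvg_euler_seq | exact: cvg_harmonic].
Qed.

End EulerLimit.

Theorem mainTheorem1 (R : realType) :
  exists (Delta_ : nat -> R) (Delta : R),
    [/\ forall (M : nat) (h : 'cV[Cplx R]_M) (mu : probability (borelMx R M) R),
          (2 <= M)%N -> sqnorm h / M%:R = 1 -> is_CUE mu ->
          MI_gap h mu snr @[snr --> +oo] --> Delta_ M,
        Delta_ M @[M --> \oo] --> Delta,
        Delta = 1 - (log2 (expR 1) - gamma2 R),
        `|Delta - 39%:R / 100%:R| < 5%:R / 10%:R ^+ 3 &
        `|gamma2 R - 833%:R / 1000%:R| < 5%:R / 10%:R ^+ 4].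
Proof.
(* The first witness depends on [M] alone: the limit is the same for every channel and every law. *)
exists (gap_limit R), (1 - (1 / ln 2 - euler_const R / ln 2)); split.
- by move=> M h mu M2 hM cue; exact: cvg_MI_gap.
- exact: cvg_gap_limit.
- by rewrite gamma2E /log2 expRK.
- exact: gap_limit_numeric.
- by rewrite gamma2E; exact: euler_const_ln2.
Qed.
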